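(* Let $p\ge 5$ be a prime. Then, modulo $p^6$, $$\sum_{k=0}^{p-1}(6k+1)\frac{\left(\frac13\right)_k^6}{k!^6}\equiv\begin{cases}-p\,\Gamma_p\left(\frac13\right)^9 & \text{if } p\equiv 1\pmod 6,\\[2pt] -\frac{10}{27}\,p^4\,\Gamma_p\left(\frac13\right)^9 & \text{if } p\equiv 5\pmod 6.\end{cases}$$ (The left side equals the truncated series $\sum_{k=0}^{p-1}\frac{(\frac13)_k(\frac76)_k(\frac13)_k^5}{(\frac16)_k(1)_k^5}\frac{1}{k!}$.)
   Context: For $a\in\mathbb{Q}$ and $k\ge 0$ an integer, $(a)_k=a(a+1)\cdots(a+k-1)$ with $(a)_0=1$. $\Gamma_p$ denotes Morita's $p$-adic Gamma function, the unique continuous function $\mathbb{Z}_p\to\mathbb{Z}_p^\times$ with $\Gamma_p(n)=(-1)^n\prod_{0<j<n,\ p\nmid j} j$ for integers $n\ge1$. For $x,y\in\mathbb{Q}_p$, $x\equiv y\pmod{p^m}$ means $v_p(x-y)\ge m$. *)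

(* Defs.v *)
From HB Require Import structures.
From mathcomp Require Import all_boot all_order all_algebra.
From mathcomp Require Import boolp classical_sets constructive_ereal filter.
From mathcomp Require Import topology_structure.

Set Implicit Arguments.
Unset Strict Implicit.
Unset Printing Implicit Defensive.

Import Order.TTheory GRing.Theory Num.Theory.
Local Open Scope classical_set_scope.
Local Open Scope ring_scope.

(* Z_p is the inverse limit of the rings Z/p^n: an element is the sequence of
   its canonical residues [residue x n], which lie in {0, ..., p^n - 1}; the
   bounds follow from the coherence condition. *)
Record padic_int (p : nat) (p_pr : prime p) := PadicInt {
  residue :> nat -> int;
  residue_coherent : forall n, residue n = (residue n.+1 %% p%:Z ^+ n)%Z }.

Section PadicInt.
Variables (p : nat) (p_pr : prime p).
Notation Zp := (padic_int p_pr).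
Implicit Types (x y z : Zp) (n m k : nat).

HB.instance Definition _ := gen_eqMixin Zp.
HB.instance Definition _ := gen_choiceMixin Zp.

Lemma padic_intP x y : x =1 y -> x = y.
Proof.
case: x y => [f fP] [g gP] /= /funext fg; subst g.
by congr PadicInt; apply: Prop_irrelevance.
Qed.

Let q_gt0 n : 0 < p%:Z ^+ n.
Proof. by rewrite exprn_gt0 // ltz_nat prime_gt0. Qed.

Let q_neq0 n : p%:Z ^+ n != 0.
Proof. by rewrite gt_eqF. Qed.

Lemma residue_ge0 x n : 0 <= x n.
Proof. by rewrite residue_coherent modz_ge0. Qed.

Lemma residue_lt x n : x n < p%:Z ^+ n.
Proof. by rewrite residue_coherent ltz_pmod. Qed.

Lemma residue_mod x n : (x n %% p%:Z ^+ n)%Z = x n.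
Proof. by rewrite modz_small // residue_ge0 residue_lt. Qed.

Let dvdq n m : (n <= m)%N -> (p%:Z ^+ n %| p%:Z ^+ m)%Z.
Proof. exact: dvdz_exp2l. Qed.

Let modq n m (a : int) : (n <= m)%N ->
  ((a %% p%:Z ^+ m)%Z %% p%:Z ^+ n)%Z = (a %% p%:Z ^+ n)%Z.
Proof.
move=> nm; rewrite {2}(divz_eq a (p%:Z ^+ m)).
have /dvdzP[c ->] := dvdq nm.
by rewrite mulrA modzMDl.
Qed.

Lemma residue_le x n m : (n <= m)%N -> x n = (x m %% p%:Z ^+ n)%Z.
Proof.
move=> /subnK <-; elim: (m - n)%N => [|k IHk]; first by rewrite residue_mod.
by rewrite IHk (residue_coherent x (k + n)) modq ?leq_addl // addSn.
Qed.

Definition of_residues (f : nat -> int)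
    (fP : forall n, (f n = f n.+1 %[mod p%:Z ^+ n])%Z) : Zp.
Proof.
exists (fun n => (f n %% p%:Z ^+ n)%Z) => n.
by rewrite modq.
Defined.

Let coh x n : (x n = x n.+1 %[mod p%:Z ^+ n])%Z.
Proof. by rewrite -residue_coherent residue_mod. Qed.

Fact const_coherent (a : int) n : (a = a %[mod p%:Z ^+ n])%Z.
Proof. by []. Qed.
Fact opp_coherent x n : (- x n = - x n.+1 %[mod p%:Z ^+ n])%Z.
Proof. by rewrite -modzNm coh modzNm. Qed.
Fact add_coherent x y n : (x n + y n = x n.+1 + y n.+1 %[mod p%:Z ^+ n])%Z.
Proof. by rewrite -modzDm !coh modzDm. Qed.
Fact mul_coherent x y n : (x n * y n = x n.+1 * y n.+1 %[mod p%:Z ^+ n])%Z.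
Proof. by rewrite -modzMm !coh modzMm. Qed.

Let const a : Zp := of_residues (const_coherent a).
Let opp x : Zp := of_residues (opp_coherent x).
Let add x y : Zp := of_residues (add_coherent x y).
Let mul x y : Zp := of_residues (mul_coherent x y).

Fact padic_addA : associative add.
Proof. by move=> x y z; apply: padic_intP => n /=; rewrite modzDml modzDmr addrA. Qed.
Fact padic_addC : commutative add.
Proof. by move=> x y; apply: padic_intP => n /=; rewrite addrC. Qed.
Fact padic_add0 : left_id (const 0) add.
Proof. by move=> x; apply: padic_intP => n /=; rewrite modzDml add0r residue_mod. Qed.
Fact padic_addN : left_inverse (const 0) opp add.
Proof. by move=> x; apply: padic_intP => n /=; rewrite modzDml addNr. Qed.

HB.instance Definition _ :=
  GRing.isZmodule.Build Zp padic_addA padic_addC padic_add0 padic_addN.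

Fact padic_mulA : associative mul.
Proof. by move=> x y z; apply: padic_intP => n /=; rewrite modzMml modzMmr mulrA. Qed.
Fact padic_mulC : commutative mul.
Proof. by move=> x y; apply: padic_intP => n /=; rewrite mulrC. Qed.
Fact padic_mul1 : left_id (const 1) mul.
Proof. by move=> x; apply: padic_intP => n /=; rewrite modzMml mul1r residue_mod. Qed.
Fact padic_mulD : left_distributive mul add.
Proof. by move=> x y z; apply: padic_intP => n /=; rewrite modzMml modzDm mulrDl. Qed.
Fact padic_1neq0 : const 1 != 0.
Proof.
apply/eqP => /(congr1 (fun x : Zp => x 1%N)) /=.
by rewrite expr1 mod0z modz_small //= ltz_nat prime_gt1.
Qed.

HB.instance Definition _ := GRing.Zmodule_isComNzRing.Build Zp
  padic_mulA padic_mulC padic_mul1 padic_mulD padic_1neq0.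

Lemma residue0 n : (0 : Zp) n = 0.
Proof. exact: mod0z. Qed.
Lemma residue1 n : (1 : Zp) n = (1 %% p%:Z ^+ n)%Z.
Proof. by []. Qed.
Lemma residueN x n : (- x) n = (- x n %% p%:Z ^+ n)%Z.
Proof. by []. Qed.
Lemma residueD x y n : (x + y) n = ((x n + y n) %% p%:Z ^+ n)%Z.
Proof. by []. Qed.
Lemma residueM x y n : (x * y) n = ((x n * y n) %% p%:Z ^+ n)%Z.
Proof. by []. Qed.

Lemma residue_nat m n : (m%:R : Zp) n = (m%:Z %% p%:Z ^+ n)%Z.
Proof.
elim: m => [|m IHm]; first by rewrite residue0 mod0z.
by rewrite -addn1 natrD residueD IHm residue1 modzDm PoszD.
Qed.

Lemma residue_eq0 x n : (x n == 0) = (p%:Z ^+ n %| x n)%Z.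
Proof. by apply/eqP/dvdz_mod0P; rewrite residue_mod. Qed.

Lemma residue_eq0_le x n m : (n <= m)%N -> (x n == 0) = (p%:Z ^+ n %| x m)%Z.
Proof. by move=> nm; rewrite (residue_le _ nm); apply/eqP/dvdz_mod0P. Qed.

Definition padic_unit := [pred x : Zp | x 1%N != 0].

Let coprime_residue x n : padic_unit x -> coprimez (x n) (p%:Z ^+ n).
Proof.
case: n => [|n]; first by rewrite expr0 /coprimez gcdz1.
rewrite /= (@residue_eq0_le x 1 n.+1) // expr1 => px.
rewrite coprimezXr // coprimez_sym /coprimez /gcdz /=.
by rewrite eqz_nat -/(coprime p _) prime_coprime.
Qed.

Let bezout_residue x n : padic_unit x ->
  ((egcdz (x n) (p%:Z ^+ n)).1 * x n = 1 %[mod p%:Z ^+ n])%Z.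
Proof.
move=> /(coprime_residue n) /eqP; case: egcdzP => u v <- _ /= <-.
by rewrite addrC modzMDl.
Qed.

Fact inv_coherent x : padic_unit x -> forall n,
  ((egcdz (x n) (p%:Z ^+ n)).1 = (egcdz (x n.+1) (p%:Z ^+ n.+1)).1
     %[mod p%:Z ^+ n])%Z.
Proof.
move=> ux n; set u := (X in (X %% _)%Z = _); set v := (X in _ = (X %% _)%Z).
have hu : (u * x n = 1 %[mod p%:Z ^+ n])%Z by apply: bezout_residue.
have hv : (v * x n = 1 %[mod p%:Z ^+ n])%Z.
  rewrite -modzMmr coh modzMmr -(@modq n n.+1 (v * _)) //.
  by rewrite bezout_residue // modq.
rewrite -[u in LHS]mulr1 -modzMmr -hv modzMmr mulrCA.
by rewrite -modzMmr hu modzMmr mulr1.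
Qed.

Let inv x : Zp :=
  if pselect (padic_unit x) is left ux then of_residues (inv_coherent ux)
  else x.

Fact padic_mulV : {in padic_unit, left_inverse 1 inv *%R}.
Proof.
move=> x ux; rewrite /inv; case: pselect => [{}ux|//].
by apply: padic_intP => n; rewrite residueM /= modzMml bezout_residue.
Qed.

Fact padic_unitP x y : y * x = 1 -> padic_unit x.
Proof.
move=> /(congr1 (fun x : Zp => x 1%N)); rewrite residueM residue1 => yx1 /=.
apply/eqP => x0; move: yx1; rewrite x0 mulr0 mod0z expr1 modz_small //.
by rewrite ltz_nat prime_gt1.
Qed.

Fact padic_inv0 : {in [predC padic_unit], inv =1 id}.
Proof. by move=> x; rewrite inE /inv => /negP; case: pselect. Qed.

HB.instance Definition _ :=
  GRing.ComNzRing_hasMulInverse.Build Zp padic_mulV padic_unitP padic_inv0.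

Lemma padic_unitE x : (x \is a GRing.unit) = (x 1%N != 0).
Proof. by []. Qed.

Lemma padic_unit_nat n : ((n%:R : Zp) \is a GRing.unit) = ~~ (p %| n)%N.
Proof.
rewrite padic_unitE residue_nat expr1; congr negb.
by apply/eqP/idP => [/dvdz_mod0P|np]; last apply/dvdz_mod0P.
Qed.

Lemma padic_neq0P x : x != 0 -> exists n, x n.+1 != 0.
Proof.
move=> x0; apply: contrapT => /forallNP x_eq0; move/eqP: x0; apply.
apply: padic_intP => n; rewrite residue0.
have /negP/negPn/eqP xS := x_eq0 n.
by rewrite residue_coherent xS mod0z.
Qed.

(* Value at x != 0 of the p-adic valuation on Z_p: the largest n such that
   x = 0 mod p^n (see [padic_int_valP]); the value at 0 is irrelevant. *)
Definition padic_int_val x : nat :=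
  if pselect (exists n, x n.+1 != 0) is left h then ex_minn h else 0.

Lemma padic_int_valP x n : x != 0 -> (x n == 0) = (n <= padic_int_val x)%N.
Proof.
move=> /padic_neq0P x_neq0; rewrite /padic_int_val.
case: pselect => [h|//]; case: ex_minnP => m xm m_min.
case: (leqP n m) => [|lt_mn].
  case: n => [|n] lt_nm; first by rewrite residue_eq0 expr0 dvd1z.
  by apply: contraTT lt_nm => /m_min; rewrite -leqNgt.
by apply: contraNF xm => /eqP xn; rewrite (residue_le x lt_mn) xn mod0z.
Qed.

Let logn_residue x n : x != 0 -> (padic_int_val x < n)%N ->
  `|x n|%N != 0%N /\ logn p `|x n| = padic_int_val x.
Proof.
move=> x0 lt_vn.
have xn0 : `|x n|%N != 0%N by rewrite absz_eq0 padic_int_valP // -ltnNge.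
have dvd k : (k <= n)%N -> (k <= logn p `|x n|)%N = (k <= padic_int_val x)%N.
  move=> le_kn; rewrite -pfactor_dvdn ?lt0n // -padic_int_valP //.
  by rewrite (residue_eq0_le x le_kn) dvdzE abszX.
split=> //; apply/eqP; rewrite eqn_leq dvd ?(ltnW lt_vn) // leqnn andbT.
by rewrite leqNgt dvd // ltnn.
Qed.

Lemma residueM_eq0 x y n : x != 0 -> y != 0 ->
  ((x * y) n == 0) = (n <= padic_int_val x + padic_int_val y)%N.
Proof.
move=> x0 y0; set a := padic_int_val x; set b := padic_int_val y.
pose N := (n + (a + b).+1)%N.
have [xN0 xN] : `|x N|%N != 0%N /\ logn p `|x N| = a.
  by apply: logn_residue => //; rewrite ltn_addl // ltnS leq_addr.
have [yN0 yN] : `|y N|%N != 0%N /\ logn p `|y N| = b.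
  by apply: logn_residue => //; rewrite ltn_addl // ltnS leq_addl.
have nN : (n <= N)%N by rewrite leq_addr.
rewrite (residue_eq0_le (x * y) nN) residueM.
have -> : (p%:Z ^+ n %| ((x N * y N) %% p%:Z ^+ N)%Z)%Z = (p%:Z ^+ n %| x N * y N)%Z.
  by apply/dvdz_mod0P/dvdz_mod0P; rewrite modq.
rewrite dvdzE abszX abszM /= pfactor_dvdn ?lognM ?lt0n ?muln_eq0 ?negb_or ?xN0 //.
by rewrite xN yN.
Qed.

Fact padic_int_integral x y : x * y = 0 -> (x == 0) || (y == 0).
Proof.
move=> xy0; apply: contraT; rewrite negb_or => /andP[x0 y0].
have := residueM_eq0 (padic_int_val x + padic_int_val y).+1 x0 y0.
by rewrite xy0 residue0 eqxx ltnn.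
Qed.

HB.instance Definition _ := GRing.ComUnitRing_isIntegral.Build Zp padic_int_integral.

Lemma padic_int_valM x y : x != 0 -> y != 0 ->
  padic_int_val (x * y) = (padic_int_val x + padic_int_val y)%N.
Proof.
move=> x0 y0; have xy0 : x * y != 0 by rewrite mulf_neq0.
have v n : (n <= padic_int_val (x * y)%R)%N =
    (n <= padic_int_val x + padic_int_val y)%N.
  by rewrite -padic_int_valP // residueM_eq0.
by apply/eqP; rewrite eqn_leq -v leqnn v leqnn.
Qed.

Lemma padic_int_val_unit x : x \is a GRing.unit -> padic_int_val x = 0%N.
Proof.
move=> ux; have x0 : x != 0 by apply: contraTneq ux => ->; rewrite unitr0.
by apply/eqP; rewrite -leqn0 leqNgt -padic_int_valP.
Qed.

Lemma residue_pexp n k : (p%:R ^+ n : Zp) k = (p%:Z ^+ n %% p%:Z ^+ k)%Z.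
Proof. by rewrite -natrX residue_nat -[Posz (p ^ n)]natz natrX natz. Qed.

Lemma residue_pexp_eq0 n k : ((p%:R ^+ n : Zp) k == 0) = (k <= n)%N.
Proof.
rewrite residue_pexp -(@dvdz_Pexp2l p%:Z) ?gtr0_norm ?ltz_nat ?prime_gt0 ?prime_gt1 //.
exact/eqP/dvdz_mod0P.
Qed.

Lemma padic_pexp_neq0 n : p%:R ^+ n != 0 :> Zp.
Proof.
apply/eqP => pn0; have := residue_pexp_eq0 n n.+1.
by rewrite pn0 residue0 eqxx ltnn.
Qed.

Lemma padic_int_val_pexp n : padic_int_val (p%:R ^+ n) = n.
Proof.
have v k : (k <= padic_int_val (p%:R ^+ n)%R)%N = (k <= n)%N.
  by rewrite -padic_int_valP ?padic_pexp_neq0 // residue_pexp_eq0.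
by apply/eqP; rewrite eqn_leq -v leqnn v leqnn.
Qed.

Lemma padic_dvdP x n : reflect (exists z, x = p%:R ^+ n * z) (x n == 0).
Proof.
apply: (iffP idP) => [xn|[z ->]]; last first.
  by rewrite residueM residue_pexp modzz mul0r mod0z.
have dvd k : (p%:Z ^+ n %| x (n + k))%Z by rewrite -residue_eq0_le ?leq_addr.
pose f k := (x (n + k)%N %/ p%:Z ^+ n)%Z.
have fK k : f k * p%:Z ^+ n = x (n + k)%N by rewrite divzK.
have fP k : (f k = f k.+1 %[mod p%:Z ^+ k])%Z.
  apply/eqP; rewrite eqz_mod_dvd -(dvdz_mul2r (q_neq0 n)) mulrBl !fK -exprD.
  by rewrite -eqz_mod_dvd addnS [(k + n)%N]addnC; apply/eqP; apply: coh.
exists (of_residues fP); apply: padic_intP => k.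
rewrite residueM residue_pexp /= modzMml modzMmr mulrC fK.
by rewrite -residue_le // leq_addl.
Qed.

(* The p-adic topology: the balls x + p^n Z_p form a basis of neighborhoods
   of x. *)
Definition padic_nbhs x : set_system Zp :=
  [set A | exists n, forall y, y n = x n -> A y].
Arguments padic_nbhs x A /.

HB.instance Definition _ := hasNbhs.Build Zp padic_nbhs.

Fact padic_nbhs_filter x : ProperFilter (nbhs x).
Proof.
split; first by case=> n /(_ x erefl).
split; first by exists 0%N.
  move=> A B [n An] [m Bm]; exists (maxn n m) => y yx; split.
    by apply: An; rewrite !(residue_le _ (leq_maxl n m)) yx.
  by apply: Bm; rewrite !(residue_le _ (leq_maxr n m)) yx.
by move=> A B AB [n An]; exists n => y /An /AB.
Qed.
Fact padic_nbhs_singleton x (A : set Zp) : nbhs x A -> A x.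
Proof. by case=> n; apply. Qed.
Fact padic_nbhs_nbhs x (A : set Zp) : nbhs x A -> nbhs x (nbhs^~ A).
Proof. by case=> n An; exists n => y yx; exists n => z zy; apply: An; rewrite zy. Qed.

HB.instance Definition _ := Nbhs_isNbhsTopological.Build Zp
  padic_nbhs_filter padic_nbhs_singleton padic_nbhs_nbhs.

End PadicInt.

Notation padic p_pr := {fraction (padic_int p_pr)}.
Notation "x %:F" := (@FracField.tofrac _ x) : ring_scope.

Section Padic.
Variables (p : nat) (p_pr : prime p).
Notation Zp := (padic_int p_pr).
Notation Qp := (padic p_pr).
Implicit Types (x y z : Zp) (u v w : Qp) (n m k : nat).

(* This does not depend on the representative of u, see [padic_val_frac]. *)
Definition padic_val u : \bar int :=
  if u == 0 then +oo%E
  else ((padic_int_val \n_(repr u))%:Z - (padic_int_val \d_(repr u))%:Z)%:E.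

Definition padic_eqmod m u v := (m%:Z%:E <= padic_val (u - v)%R)%E.

Lemma fraction_repr u : u = (\n_(repr u))%:F / (\d_(repr u))%:F.
Proof.
set r := repr u; have d0 : (\d_r)%:F != 0 :> Qp by rewrite tofrac_eq0 denom_ratioP.
apply: (canRL (mulfK d0)); rewrite -[u]reprK -/r; unlock FracField.tofrac.
rewrite -[LHS]FracField.pi_mul; apply/eqmodP; rewrite /= FracField.equivfE.
by rewrite /FracField.mulf !numden_Ratio ?oner_eq0 ?mulr1 ?denom_ratioP // mulrC.
Qed.

Lemma padic_val_frac x y : x != 0 -> y != 0 ->
  padic_val (x%:F / y%:F) = ((padic_int_val x)%:Z - (padic_int_val y)%:Z)%:E.
Proof.
move=> x0 y0; rewrite /padic_val; set u := x%:F / y%:F.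
have u0 : u != 0 by rewrite mulf_neq0 ?invr_eq0 ?tofrac_eq0.
have := fraction_repr u; rewrite (negPf u0).
set a := \n_(repr u); set b := \d_(repr u) => uE.
have b0 : b != 0 by exact: denom_ratioP.
have a0 : a != 0.
  by apply: contraNneq u0 => a0; rewrite uE a0 tofrac0 mul0r.
have /eqP : x%:F * b%:F = a%:F * y%:F :> Qp.
  by apply/eqP; rewrite -eqr_div ?tofrac_eq0 // -uE.
rewrite -!tofracM tofrac_eq => /eqP /(congr1 (@padic_int_val _ _)).
rewrite !padic_int_valM // => e; congr EFin.
by apply/eqP; rewrite subr_eq addrAC eq_sym subr_eq -!PoszD e.
Qed.

Lemma padic_eqmodP m u v :
  reflect (exists z, u - v = p%:R ^+ m * z%:F) (padic_eqmod m u v).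
Proof.
rewrite /padic_eqmod; set w := u - v.
have pm : p%:R ^+ m = (p%:R ^+ m : Zp)%:F :> Qp by rewrite rmorphXn rmorph_nat.
have [w0|w0] := eqVneq w 0.
  rewrite w0 /padic_val eqxx leey; constructor.
  by exists 0; rewrite rmorph0 mulr0.
apply: (iffP idP) => [|[z wE]]; last first.
  have z0 : z != 0 by apply: contraNneq w0 => z0; rewrite wE z0 tofrac0 mulr0.
  have -> : w = (p%:R ^+ m * z)%:F / 1%:F.
    by rewrite wE pm tofrac1 divr1 tofracM.
  rewrite padic_val_frac ?mulf_neq0 ?padic_pexp_neq0 ?oner_eq0 //.
  rewrite padic_int_valM ?padic_pexp_neq0 // padic_int_val_pexp.
  by rewrite (padic_int_val_unit (unitr1 _)) subr0 lee_fin lez_nat leq_addr.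
rewrite /padic_val (negPf w0) lee_fin.
have := fraction_repr w; set a := \n_(repr w); set b := \d_(repr w) => wE.
have b0 : b != 0 by exact: denom_ratioP.
have a0 : a != 0 by apply: contraNneq w0 => a0; rewrite wE a0 tofrac0 mul0r.
rewrite lerBrDr -PoszD lez_nat -padic_int_valP // => /padic_dvdP[z aE].
have /padic_dvdP[c bE] : b (padic_int_val b) == 0 by rewrite padic_int_valP.
have c0 : c != 0 by apply: contraNneq b0 => c0; rewrite bE c0 mulr0.
have uc : c \is a GRing.unit.
  rewrite padic_unitE padic_int_valP // -ltnNge ltnS leqn0.
  have := congr1 (@padic_int_val _ _) bE.
  rewrite padic_int_valM ?padic_pexp_neq0 // padic_int_val_pexp => /eqP.
  by rewrite -[X in X == _]addn0 eqn_add2l eq_sym.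
exists (z / c); rewrite wE aE bE pm -tofracM; apply/eqP.
rewrite -[X in _ == X]divr1 -tofrac1 eqr_div ?tofrac_eq0 ?oner_eq0 -?bE //.
rewrite -!tofracM tofrac_eq mulr1; apply/eqP; rewrite [in RHS]bE exprD -!mulrA.
by congr (_ * _); rewrite [c^-1 * _]mulrCA mulVr // mulr1 mulrC.
Qed.
End Padic.

Section MoritaGamma.
Variables (p : nat) (p_pr : prime p).
Notation Zp := (padic_int p_pr).
Implicit Types (x y : Zp) (n m k N : nat).

Definition is_morita_gamma (G : Zp -> Zp) :=
  [/\ continuous G,
      forall x, G x \is a GRing.unit
    & forall n, (0 < n)%N ->
        G n%:R = (-1) ^+ n * \prod_(1 <= j < n | ~~ (p %| j)%N) j%:R].

Lemma is_morita_gamma_unique G H :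
  is_morita_gamma G -> is_morita_gamma H -> G = H.
Proof.
move=> [Gc _ Gn] [Hc _ Hn]; apply/funext => x; apply: padic_intP => m.
have ball (z : Zp) : nbhs z [set y : Zp | y m = z m] by exists m.
have [n1 Gx] := Gc x _ (ball (G x)); have [n2 Hx] := Hc x _ (ball (H x)).
pose n := maxn n1 n2; pose N := (`|x n| + p ^ n)%N.
have N0 : (0 < N)%N by rewrite addn_gt0 expn_gt0 (prime_gt0 p_pr) orbT.
have Nx : (N%:R : Zp) n = x n.
  rewrite residue_nat PoszD gez0_abs ?residue_ge0 //.
  by rewrite -[Posz (p ^ n)]natz natrX natz modzDr residue_mod.
have GN : G N%:R m = G x m.
  by apply: Gx; rewrite !(residue_le _ (leq_maxl n1 n2)) Nx.
have HN : H N%:R m = H x m.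
  by apply: Hx; rewrite !(residue_le _ (leq_maxr n1 n2)) Nx.
by rewrite -GN -HN Gn // Hn.
Qed.

(* A function as above exists for odd p, see [morita_gammaP]: the default value
   of [xget] is then not used. *)
Definition morita_gamma : Zp -> Zp :=
  xget (fun=> 1) [set G | is_morita_gamma G].

Let gam N : int := (-1) ^+ N * \prod_(1 <= j < N | ~~ (p %| j)%N) j%:Z.

Let gam_intr (R : pzRingType) N :
  (gam N)%:~R = (-1) ^+ N * \prod_(1 <= j < N | ~~ (p %| j)%N) j%:R :> R.
Proof.
rewrite rmorphM rmorph_sign; congr (_ * _).
by rewrite rmorph_prod; apply: eq_bigr => j _; rewrite pmulrn.
Qed.

Let prod_units N :
  (\prod_(1 <= j < N | ~~ (p %| j)) j = \prod_(0 <= j < N | ~~ (p %| j)) j)%N.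
Proof. by case: N => [|N]; [rewrite !big_geq | rewrite [RHS]big_ltn_cond ?dvdn0]. Qed.

Let Fp_units k : ((\prod_(0 <= j < k * p | ~~ (p %| j)) j)%N%:R = (-1) ^+ k :> 'F_p).
Proof.
have p0 : p%:R = 0 :> 'F_p by rewrite pchar_Fp_0.
elim: k => [|k IHk]; first by rewrite mul0n big_nil.
rewrite (@big_cat_nat _ _ _ (k * p)) ?leq_mul2r ?leqnSn ?orbT //= natrM IHk.
rewrite exprSr; congr (_ * _).
rewrite -[X in \prod_(X <= _ < _ | _) _]add0n big_addn -mulnBl subSnn mul1n.
transitivity (((p.-1)`!)%:R : 'F_p).
  rewrite fact_prod !natr_prod prednK ?prime_gt0 //.
  rewrite big_ltn_cond ?prime_gt0 // dvdn_addl ?dvdn_mull // dvdn0 /=.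
  rewrite big_nat_cond [RHS]big_nat_cond; apply: eq_big => [j|j _].
    rewrite andbT; have [/andP[j1 jp]|//] := boolP (0 < j < p)%N.
    by rewrite dvdn_addl ?dvdn_mull // gtnNdvd.
  by rewrite natrD natrM p0 mulr0 addr0.
have := Wilson (prime_gt1 p_pr); rewrite p_pr => /esym pdvd.
by apply/eqP; rewrite -addr_eq0 natr1 -(dvdn_pcharf (pchar_Fp p_pr)).
Qed.

Let Zq_units n : (0 < n)%N -> let u : 'Z_(p ^ n) :=
  (\prod_(0 <= j < p ^ n | ~~ (p %| j)) j)%N%:R in u * u = 1.
Proof.
move=> n0; have q1 : (1 < p ^ n)%N by rewrite -(exp1n n) ltn_exp2r ?prime_gt1.
suff -> : (\prod_(0 <= j < p ^ n | ~~ (p %| j)) j)%N%:R =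
    \prod_(z : 'Z_(p ^ n) | z \is a GRing.unit) z.
  rewrite /= [X in X * _](reindex_inj invr_inj) /=.
  rewrite (eq_bigl (fun z : 'Z_(p ^ n) => z \is a GRing.unit)).
    by rewrite -big_split big1 //= => z uz; rewrite mulVr.
  by move=> z; rewrite unitrV.
rewrite natr_prod -[X in \prod_(_ <= _ < X | _) _](Zp_cast q1) big_mkord.
apply: eq_big => [z|z _]; last by rewrite natr_Zp.
by rewrite -[z in RHS]natr_Zp unitZpE // coprime_pexpl // prime_coprime.
Qed.

Let Zq_intr n (k : int) : (0 < n)%N ->
  (k%:~R : 'Z_(p ^ n)) = 0 -> (p%:Z ^+ n %| k)%Z.
Proof.
move=> n0; have q1 : (1 < p ^ n)%N by rewrite -(exp1n n) ltn_exp2r ?prime_gt1.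
rewrite dvdzE abszX; case: k => m; rewrite ?NegzE ?mulrNz ?abszN => /eqP.
  by move=> /eqP /(congr1 val) /=; rewrite val_Zp_nat // => /eqP.
by rewrite oppr_eq0 => /eqP /(congr1 val) /=; rewrite val_Zp_nat // => /eqP.
Qed.

Let q_units n : odd p ->
  (p%:Z ^+ n %| (\prod_(0 <= j < p ^ n | ~~ (p %| j)) j)%N%:Z + 1)%Z.
Proof.
case: n => [|n] p_odd; first exact: dvd1z.
set W := (\prod_(_ <= j < _ | _) _)%N.
have q1 : (1 < p ^ n.+1)%N by rewrite -(exp1n n.+1) ltn_exp2r ?prime_gt1.
have dvdW : (p%:Z ^+ n.+1 %| (W%:Z - 1) * (W%:Z + 1))%Z.
  rewrite -subr_sqr_1; apply: Zq_intr => //.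
  by rewrite rmorphB rmorphXn rmorph1 expr2 /= Zq_units // subrr.
rewrite Gauss_dvdzr // in dvdW.
rewrite coprimezXl // /coprimez /gcdz eqz_nat -/(coprime _ _) prime_coprime //.
apply/negP => pW.
have : (W%:R - 1 : 'F_p) = 0.
  have : (p %| W%:Z - 1)%Z by [].
  by rewrite (dvdz_pcharf (pchar_Fp p_pr)) rmorphB rmorph1 => /eqP.
have -> : W%:R = -1 :> 'F_p.
  by rewrite /W expnSr Fp_units -signr_odd oddX p_odd orbT.
move/eqP; rewrite -opprD oppr_eq0 -(natrD _ 1 1) -(dvdn_pcharf (pchar_Fp p_pr)).
by rewrite dvdn_prime2 // => /eqP p2; rewrite p2 in p_odd.
Qed.

Let gam_step n N : odd p -> (gam (N + p ^ n) = gam N %[mod p%:Z ^+ n])%Z.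
Proof.
move=> p_odd; case: n => [|n]; first by rewrite expr0 !modz1.
have q1 : (1 < p ^ n.+1)%N by rewrite -(exp1n n.+1) ltn_exp2r ?prime_gt1.
have q0 : (p ^ n.+1)%:R = 0 :> 'Z_(p ^ n.+1) by apply: pchar_Zp.
have qE : (p ^ n.+1)%:Z = p%:Z ^+ n.+1 by rewrite -[LHS]natz natrX natz.
apply/eqP; rewrite eqz_mod_dvd; apply: Zq_intr => //.
rewrite intrB !gam_intr -signr_odd oddD oddX p_odd orbT addbT signrN.
rewrite signr_odd (@big_cat_nat _ _ _ (p ^ n.+1)) ?leq_addl ?(ltnW q1) //=.
rewrite -natr_prod prod_units.
have /dvdzP[c /(canRL (addrK _))] := q_units n.+1 p_odd.
rewrite -qE => /(congr1 (fun k : int => k%:~R : 'Z_(p ^ n.+1))).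
rewrite intrB intrM -![(Posz _)%:~R]/(_%:R) q0 mulr0 sub0r => ->. 
rewrite mulN1r mulrNN -[X in _ - _ * X]natr_prod prod_units natr_prod.
rewrite -[X in \prod_(X <= _ < _ + _ | _) _]add0n big_addn addnK.
apply/eqP; rewrite subr_eq0; apply/eqP; congr (_ * _).
apply: eq_big => [j|j _]; last by rewrite natrD q0 addr0.
by rewrite dvdn_addl // dvdn_exp.
Qed.

Let gam_mod n a b : odd p -> (a = b %[mod p ^ n])%N ->
  (gam a = gam b %[mod p%:Z ^+ n])%Z.
Proof.
move=> p_odd ab.
have step k N : (gam (k * p ^ n + N) = gam N %[mod p%:Z ^+ n])%Z.
  by elim: k => // k IHk; rewrite mulSn addnAC -addnA addnC gam_step // addnC.
by rewrite (divn_eq a (p ^ n)) (divn_eq b (p ^ n)) !step ab.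
Qed.

Let residue_int (k : int) n : (k%:~R : Zp) n = (k %% p%:Z ^+ n)%Z.
Proof.
case: k => m; first exact: residue_nat.
by rewrite NegzE mulrNz residueN residue_nat modzNm.
Qed.

Lemma is_morita_gamma_ex : odd p -> exists G, is_morita_gamma G.
Proof.
move=> p_odd.
have qE n : (p ^ n)%:Z = p%:Z ^+ n by rewrite -[LHS]natz natrX natz.
have xE (x : Zp) n m : (n <= m)%N -> (`|x n| = `|x m| %[mod p ^ n])%N.
  move=> nm; apply/eqP; rewrite -eqz_nat -!modz_nat qE.
  by rewrite !gez0_abs ?residue_ge0 // (residue_le x nm) modz_mod.
pose G (x : Zp) := @of_residues p p_pr _
  (fun n => gam_mod p_odd (xE x n n.+1 (leqnSn n))).
have GE (x : Zp) n : G x n = ((gam `|x n|)%:~R : Zp) n by rewrite residue_int.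
exists G; split=> [x A [n An]|x|n n0].
- by exists n => y yx; apply: An; rewrite !GE yx.
- rewrite padic_unitE GE -padic_unitE gam_intr unitrM unitrX ?unitrN1 //=.
  by apply: unitr_prod => j; rewrite padic_unit_nat.
- apply: padic_intP => m; rewrite -gam_intr residue_int; apply: gam_mod => //.
  apply/eqP; rewrite -eqz_nat -!modz_nat qE gez0_abs ?residue_ge0 //.
  by rewrite residue_nat modz_mod.
Qed.

Lemma morita_gammaP : odd p -> is_morita_gamma morita_gamma.
Proof.
move=> /is_morita_gamma_ex[G GP].
exact: (@xgetPex _ (fun=> 1) [set G | is_morita_gamma G] (ex_intro _ G GP)).
Qed.

End MoritaGamma.

Definition pochhammer (a : rat) (k : nat) : rat := \prod_(i < k) (a + i%:R).

(* Main.v *)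
(* A sum like this one, but with the parameters 1/3 replaced by 1/3 + z^i y
   (z a primitive fifth root of unity, i < 5), depends only on y^5, and it
   vanishes mod p as a power series in y^5 because its terms are antisymmetric
   under k -> n - k when 1/3 = - n mod p. So for y divisible by p the change
   from y = 0 does not affect it mod p^6. Take n = (r p - 1) / 3 with r = 1 or 2
   and y = - r p / 3: then 1/3 + y = - n, and Dougall's 7F6 formula evaluates
   the sum as a finite product, which is a quotient of values of the p-adic
   Gamma function times p (if r = 1) or 10 p^4 / 27 (if r = 2).
   On p Z_p the p-adic Gamma function agrees modulo p^d, d < p, with a
   polynomial E with p-integral coefficients, because its finite differences
   of order i along p Z are divisible by p^i. Written in terms of 1/3 and of
   the z^i y, the Gamma quotient is therefore modulo p^d a function of y
   invariant under y -> z y, hence congruent (d <= 5) to its value at y = 0,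
   which is - Gamma_p(1/3)^9. All congruences are taken in the ring of
   algebraic numbers integral at the places above p. *)

From HB Require Import structures.
Require Import Defs.
From mathcomp Require Import all_boot all_order all_algebra all_field.
From mathcomp Require Import boolp filter topology_structure.
From mathcomp Require Import zify ring.

Set Implicit Arguments.
Unset Strict Implicit.
Unset Printing Implicit Defensive.

Import Order.TTheory GRing.Theory Num.Theory.
Local Open Scope ring_scope.

(** * Congruences between p-integral algebraic numbers *)

(** Gamma_p has no meaning at the algebraic numbers z^i y, which is why a polynomial replaces it
    near 0. Its functional and reflection equations pass to that polynomial because a congruence
    modulo p^d between polynomials on multiples of p need only be tested at d of them. The price is
    a bounded precision: d <= p - 1 for the polynomial, and d <= 5 for the symmetrization over the
    fifth roots of unity. The leading factor makes up for the rest: p times a congruence modulo p^5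
    if r = 1, p^4 times one modulo p^2 if r = 2. For p = 5, where d = 5 is out of reach, r = 2 and d
    = 2 is enough, while r = 1 forces p >= 7. *)

Section Congruence.
Variables (R : comNzRingType) (S : subringClosed R) (q : R).
Hypothesis Sq : q \in S.

Definition eqm (x y : R) : Prop := exists2 z, z \in S & x - y = q * z.

Lemma eqm_refl x : eqm x x.
Proof. by exists 0; rewrite ?rpred0 // subrr mulr0. Qed.

Lemma eq_eqm x y : x = y -> eqm x y.
Proof. by move=> ->; apply: eqm_refl. Qed.

Lemma eqm_sym x y : eqm x y -> eqm y x.
Proof.
by case=> z Sz e; exists (- z); rewrite ?rpredN // mulrN -e opprB.
Qed.

Lemma eqm_trans y x z : eqm x y -> eqm y z -> eqm x z.
Proof.
case=> u Su eu [v Sv ev]; exists (u + v); first exact: rpredD.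
by rewrite mulrDr -eu -ev addrA subrK.
Qed.

Lemma eqmD x x' y y' : eqm x x' -> eqm y y' -> eqm (x + y) (x' + y').
Proof.
case=> u Su eu [v Sv ev]; exists (u + v); first exact: rpredD.
by rewrite mulrDr -eu -ev opprD addrACA.
Qed.

Lemma eqmN x x' : eqm x x' -> eqm (- x) (- x').
Proof.
case=> u Su eu; exists (- u); first by rewrite rpredN.
by rewrite mulrN -eu opprB opprK addrC.
Qed.

Lemma eqmB x x' y y' : eqm x x' -> eqm y y' -> eqm (x - y) (x' - y').
Proof. by move=> h1 h2; apply: eqmD => //; apply: eqmN. Qed.

Lemma eqm_mem x y : eqm x y -> y \in S -> x \in S.
Proof.
case=> z Sz /eqP; rewrite subr_eq => /eqP -> Sy.
by rewrite rpredD ?rpredM.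
Qed.

Lemma eqmMl x y y' : x \in S -> eqm y y' -> eqm (x * y) (x * y').
Proof.
move=> Sx [v Sv ev]; exists (x * v); first exact: rpredM.
by rewrite -mulrBr ev mulrCA.
Qed.

Lemma eqmMr x y y' : x \in S -> eqm y y' -> eqm (y * x) (y' * x).
Proof. by move=> Sx h; rewrite ![_ * x]mulrC; apply: eqmMl. Qed.

Lemma eqmM x x' y y' : x' \in S -> y' \in S ->
  eqm x x' -> eqm y y' -> eqm (x * y) (x' * y').
Proof.
move=> Sx Sy ex ey; apply: (eqm_trans (eqmMl _ ey)); first exact: eqm_mem Sx.
exact: eqmMr.
Qed.

Lemma eqmX n x x' : x' \in S -> eqm x x' -> eqm (x ^+ n) (x' ^+ n).
Proof.
move=> Sx ex; elim: n => [|n IHn]; first exact: eqm_refl.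
by rewrite !exprS; apply: eqmM => //; apply: rpredX.
Qed.

Lemma eqm_sum (I : Type) (r : seq I) (P : pred I) (F G : I -> R) :
  (forall i, P i -> eqm (F i) (G i)) ->
  eqm (\sum_(i <- r | P i) F i) (\sum_(i <- r | P i) G i).
Proof.
by move=> h; elim/big_rec2: _ => [|i y1 y2 Pi]; [exact: eqm_refl | apply/eqmD/h].
Qed.

Lemma eqm_sum0 (I : Type) (r : seq I) (P : pred I) (F : I -> R) :
  (forall i, P i -> eqm (F i) 0) -> eqm (\sum_(i <- r | P i) F i) 0.
Proof.
move=> h; elim/big_ind: _ => [|x y hx hy|//]; first exact: eqm_refl.
by rewrite -(addr0 0); apply: eqmD.
Qed.

Lemma eqm_prod (I : eqType) (r : seq I) (P : pred I) (F G : I -> R) :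
  (forall i, i \in r -> P i -> G i \in S) ->
  (forall i, i \in r -> P i -> eqm (F i) (G i)) ->
  eqm (\prod_(i <- r | P i) F i) (\prod_(i <- r | P i) G i).
Proof.
move=> hS h; rewrite big_seq_cond [X in eqm _ X]big_seq_cond.
suff [] : eqm (\prod_(i <- r | (i \in r) && P i) F i)
    (\prod_(i <- r | (i \in r) && P i) G i) /\
    (\prod_(i <- r | (i \in r) && P i) G i) \in S by [].
elim/big_rec2: _ => [|i y1 y2 /andP[ir Pi] [e1 e2]].
  by split; [exact: eqm_refl | exact: rpred1].
split; first by apply: eqmM; rewrite ?hS //; exact: h.
by rewrite rpredM ?hS.
Qed.

Lemma eqm_horner (f : {poly R}) x y : f \is a polyOver S -> y \in S ->
  eqm x y -> eqm f.[x] f.[y].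
Proof.
move=> Sf Sy exy; rewrite !horner_coef; apply: eqm_sum => i _.
by apply: eqmMl; [apply: (polyOverP Sf) | apply: eqmX].
Qed.

Lemma eqm0P x : eqm x 0 <-> exists2 z, z \in S & x = q * z.
Proof. by rewrite /eqm subr0. Qed.

Lemma eqm_sub0 x y : eqm x y -> eqm (x - y) 0.
Proof. by rewrite /eqm subr0. Qed.

Lemma sub0_eqm x y : eqm (x - y) 0 -> eqm x y.
Proof. by rewrite /eqm subr0. Qed.

End Congruence.

Lemma eqm_dvd (R : comNzRingType) (S : subringClosed R) (q c : R) x y :
  c \in S -> eqm S (q * c) x y -> eqm S q x y.
Proof. by move=> Sc [z Sz e]; exists (c * z); rewrite ?rpredM // mulrA. Qed.

Lemma eqm_scale (R : comNzRingType) (S : subringClosed R) (q c : R) x y :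
  eqm S q x y -> eqm S (c * q) (c * x) (c * y).
Proof. by move=> [z Sz e]; exists z => //; rewrite -mulrBr e mulrA. Qed.

(* The algebraic numbers integral at all places above p: the localization of
   the algebraic integers at the elements k + p w with k prime to p. *)
Definition pint (p : nat) : {pred algC} := fun x =>
  `[< exists (k : int) (w : algC),
      [/\ coprimez k p, w \in Aint & (k%:~R + p%:R * w) * x \in Aint] >].

Lemma pintP (p : nat) x : reflect (exists (k : int) (w : algC),
    [/\ coprimez k p, w \in Aint & (k%:~R + p%:R * w) * x \in Aint])
  (x \in pint p).
Proof. exact: asboolP. Qed.

Lemma Aint_pint p x : x \in Aint -> x \in pint p.
Proof.
move=> Ax; apply/pintP; exists 1, 0; split; rewrite ?rpred0 //.
  by rewrite /coprimez gcd1z.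
by rewrite mulr0 addr0 mul1r.
Qed.

Lemma pint_subring_closed p : subring_closed (pint p).
Proof.
have key (k k' : int) (w w' : algC) : w \in Aint -> w' \in Aint ->
    exists2 w'', w'' \in Aint &
    (k%:~R + p%:R * w) * (k'%:~R + p%:R * w') = (k * k')%:~R + p%:R * w''.
  move=> Aw Aw'; exists (k%:~R * w' + k'%:~R * w + p%:R * w * w').
    by rewrite !rpredD ?rpredM ?rpred_nat ?rpred_int.
  by rewrite intrM; ring.
have memb (k : int) (w : algC) : w \in Aint -> k%:~R + p%:R * w \in Aint.
  by move=> Aw; rewrite rpredD ?rpredM ?rpred_nat ?rpred_int.
split=> [|x y|x y]; first by rewrite Aint_pint ?rpred1.
- move=> /pintP[k [w [ck Aw Ax]]] /pintP[k' [w' [ck' Aw' Ay]]].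
  have [w2 Aw2 e] := key k k' w w' Aw Aw'.
  apply/pintP; exists (k * k'), w2; split=> //; first by rewrite coprimezMl ck.
  rewrite -e mulrBr mulrAC -mulrA [X in _ - X]mulrAC -mulrA -mulrBr.
  set X := (X in X \in _).
  have -> : X = (k'%:~R + p%:R * w') * ((k%:~R + p%:R * w) * x)
     - (k%:~R + p%:R * w) * ((k'%:~R + p%:R * w') * y) by rewrite /X; ring.
  by apply: rpredB; apply: rpredM => //; apply: memb.
- move=> /pintP[k [w [ck Aw Ax]]] /pintP[k' [w' [ck' Aw' Ay]]].
  have [w2 Aw2 e] := key k k' w w' Aw Aw'.
  apply/pintP; exists (k * k'), w2; split=> //; first by rewrite coprimezMl ck.
  by rewrite -e mulrACA; apply: rpredM.
Qed.

HB.instance Definition _ p :=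
  GRing.isSubringClosed.Build algC (pint p) (pint_subring_closed p).

(** If [b] is an admissible denominator of [w], then [b * x] with x = k + p w is again of the
    admissible form, and it clears the denominator of [x^-1]. *)
Lemma pint_unit (p : nat) (k : int) w : coprimez k p -> w \in pint p ->
  (k%:~R + p%:R * w)^-1 \in pint p.
Proof.
move=> ck /pintP[k' [w' [ck' Aw' Aw]]]; set b := k'%:~R + _ in Aw.
have Ab : b \in Aint by rewrite rpredD ?rpredM ?rpred_nat ?rpred_int.
apply/pintP; exists (k * k'), (k%:~R * w' + b * w); split.
- by rewrite coprimezMl ck.
- by apply: rpredD => //; apply: rpredM => //; apply: rpred_int.
set x := k%:~R + p%:R * w.
have -> : (k * k')%:~R + p%:R * (k%:~R * w' + b * w) = b * x.
  by rewrite intrM /b /x; ring.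
have [-> | x0] := eqVneq x 0; first by rewrite invr0 mulr0 rpred0.
by rewrite mulfK.
Qed.

Lemma pint_int_inv (p : nat) (k : int) : coprimez k p -> k%:~R^-1 \in pint p.
Proof. by move=> ck; have := pint_unit ck (rpred0 _); rewrite mulr0 addr0. Qed.

Lemma pint_nat_inv p m : coprime m p -> m%:R^-1 \in pint p.
Proof. by move=> c; apply: (@pint_int_inv p m). Qed.

Lemma pint_eqm_unit (p : nat) (k : int) x : coprimez k p ->
  eqm (pint p) p%:R x k%:~R -> x^-1 \in pint p.
Proof.
move=> ck [w Sw /eqP]; rewrite subr_eq addrC => /eqP ->; exact: pint_unit.
Qed.

(** This brings congruences from the algebraic numbers back to the rationals. If p divided the
    denominator, clearing the rest of it would make k * numq r / p a rational algebraic integer,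
    hence an integer, although p is prime to both [k] and [numq r]. *)
Lemma pint_rat (p : nat) (r : rat) : prime p -> ratr r \in pint p -> coprimez (denq r) p.
Proof.
move=> p_pr /pintP[k [w [ck Aw]]].
rewrite coprimez_sym /coprimez /gcdz /= eqz_nat -/(coprime _ _) prime_coprime //.
move=> Ax; apply/negP => /dvdnP[d' ed].
have p0 : p%:R != 0 :> algC by rewrite pnatr_eq0 -lt0n prime_gt0.
have dE : (denq r)%:~R = d'%:R * p%:R :> algC.
  by rewrite -natrM -ed -{1}(gtz0_abs (denq_gt0 r)).
have d'0 : d'%:R != 0 :> algC.
  have : (denq r)%:~R != 0 :> algC by rewrite intr_eq0 denq_eq0.
  by rewrite dE mulf_eq0 negb_or => /andP[].
set y := _ * ratr r in Ax.
have e : (k * numq r)%:~R / p%:R = d'%:R * y - w * (numq r)%:~R.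
  rewrite /y /ratr dE intrM; field; by rewrite p0 d'0.
have Az : (k * numq r)%:~R / p%:R \in Aint.
  by rewrite e; apply: rpredB; apply: rpredM => //; rewrite ?rpred_nat ?rpred_int.
have Rz : (k * numq r)%:~R / p%:R \in Crat.
  by rewrite rpred_div ?rpred_int ?rpred_nat.
have /intrP[m em] := Cint_rat_Aint Rz Az.
have {}em : k * numq r = p%:Z * m.
  apply: (@intr_inj algC); rewrite [RHS]intrM -em; field; exact: p0.
have : (p%:Z %| k * numq r)%Z by rewrite em dvdz_mulr.
rewrite Gauss_dvdzr; last by rewrite coprimez_sym.
rewrite dvdzE /= => pn; have := coprime_num_den r.
have : (p %| gcdn `|numq r| `|denq r|)%N by rewrite dvdn_gcd pn ed dvdn_mull.
rewrite /coprime => pg /eqP g1; move: pg; rewrite g1 dvdn1 => /eqP p1; by rewrite p1 in p_pr.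
Qed.

Lemma pint_pinv (p : nat) : prime p -> p%:R^-1 \notin pint p.
Proof.
move=> p_pr; apply/negP => Sp; have p0 := prime_gt0 p_pr.
have := @pint_rat p p%:R^-1 p_pr; rewrite fmorphV rmorph_nat => /(_ Sp).
have -> : p%:R^-1 = p%:~R^-1 :> rat by [].
rewrite -div1r -[1]/(1%:~R) coprimeq_den ?coprime1n //.
have -> : (p%:Z == 0) = false by apply/negP => /eqP[] p00; rewrite p00 in p0.
rewrite /coprimez /gcdz /= gcdnn eqz_nat => /eqP p1.
by rewrite p1 in p_pr.
Qed.

(** Otherwise p would divide [k] in the ring [pint p], and a Bezout relation would make p invertible
    there. *)
Lemma pint_eqm_neq0 (p : nat) (k : int) x : prime p -> coprimez k p ->
  eqm (pint p) p%:R x k%:~R -> x != 0.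
Proof.
move=> p_pr ck [w Sw e]; apply: contraNneq (pint_pinv p_pr) => x0.
have p0 : p%:R != 0 :> algC by rewrite pnatr_eq0 -lt0n prime_gt0.
have [u [v uv]] := Bezoutz k p; rewrite (eqP ck) in uv.
have kE : k%:~R = - (p%:R * w) :> algC by rewrite -e x0 sub0r opprK.
have h : 1 = p%:R * (v%:~R - u%:~R * w) :> algC.
  have : (u * k + v * p%:Z)%:~R = 1 :> algC by rewrite uv.
  rewrite intrD !intrM kE => e1; rewrite -[LHS]e1 -[(p%:Z)%:~R]/(p%:R).
  by ring.
have -> : p%:R^-1 = v%:~R - u%:~R * w by apply: (mulfI p0); rewrite -h mulfV.
by rewrite rpredB ?rpredM ?rpred_int.
Qed.

(** * Interpolation and finite differences *)

Section Interpolation.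
Variables (p : nat) (p_pr : prime p).

Lemma pint_small_inv m : (0 < m < p)%N -> m%:R^-1 \in pint p.
Proof.
move=> /andP[m0 mp]; apply: pint_nat_inv.
by rewrite coprime_sym prime_coprime // gtnNdvd.
Qed.

(** Induction on the number of nodes: write g - g(a) = (X - a) q. At the other nodes the values of
    [q] are integral because 0 < m - a < p makes m - a a unit, and [q] has smaller degree. *)
Lemma pint_interpolation d a (g : {poly algC}) : (a + d <= p)%N ->
  (size g <= d)%N -> (forall m, (a <= m < a + d)%N -> g.[m%:R] \in pint p) ->
  forall t, t \in pint p -> g.[t] \in pint p.
Proof.
elim: d a g => [|d IHd] a g ad sg gm t St.
  by move: sg; rewrite leqn0 size_poly_eq0 => /eqP ->; rewrite horner0 rpred0.
have rg : root (g - (g.[a%:R])%:P) a%:R by rewrite rootE !hornerE subrr.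
have Sga : g.[a%:R] \in pint p by apply: gm; lia.
have [q eq] := factor_theorem _ _ rg.
have {eq} eg : g = q * ('X - a%:R%:P) + (g.[a%:R])%:P by rewrite -eq subrK.
have gt x : g.[x] = q.[x] * (x - a%:R) + g.[a%:R] by rewrite {1}eg !hornerE.
rewrite gt rpredD ?rpredM ?rpredB ?rpred_nat //.
apply: (IHd a.+1) => //; first by lia.
- have [->|q0] := eqVneq q 0; first by rewrite size_poly0.
  have sq : size (q * ('X - a%:R%:P)) = (size q).+1.
    by rewrite size_Mmonic ?monicXsubC // size_XsubC addn2.
  rewrite -ltnS -sq; apply: leq_trans sg.
  rewrite eg size_polyDl // sq ltnS.
  by apply: leq_trans (size_polyC_leq1 _) _; rewrite size_poly_gt0.
- move=> m hm; have hma : (0 < m - a < p)%N by lia.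
  have ma0 : (m - a)%:R != 0 :> algC by rewrite pnatr_eq0; lia.
  have -> : q.[m%:R] = (g.[m%:R] - g.[a%:R]) * (m - a)%:R^-1.
    by rewrite gt addrK natrB ?mulfK //; [rewrite -natrB //; lia | lia].
  by rewrite rpredM ?rpredB ?pint_small_inv //; apply: gm; lia.
Qed.

(** The coefficients of degree at least d contribute multiples of p^d to f(p t). The remaining part,
    divided by p^d, has degree below d as a polynomial in t, so [pint_interpolation] applies to
    it. *)
Lemma eqm_interpolation d (f : {poly algC}) : (d <= p)%N ->
  f \is a polyOver (pint p) ->
  (forall m, (m < d)%N -> eqm (pint p) (p%:R ^+ d) f.[p%:R * m%:R] 0) ->
  forall t, t \in pint p -> eqm (pint p) (p%:R ^+ d) f.[p%:R * t] 0.
Proof.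
move=> dp Sf fm t St.
have p0 : p%:R != 0 :> algC by rewrite pnatr_eq0 -lt0n prime_gt0.
pose g := (p%:R ^+ d)^-1 *: (take_poly d f \Po (p%:R *: 'X)).
have fE x : f.[p%:R * x] =
    p%:R ^+ d * g.[x] + p%:R ^+ d * (x ^+ d * (drop_poly d f).[p%:R * x]).
  rewrite -{1}(poly_take_drop d f) !hornerE horner_comp !hornerE.
  rewrite exprMn /= divff ?expf_neq0 // mul1r; ring.
have Sd : drop_poly d f \is a polyOver (pint p).
  by apply/polyOverP => i; rewrite coef_drop_poly; apply: (polyOverP Sf).
have Sdx x : x \in pint p -> x ^+ d * (drop_poly d f).[p%:R * x] \in pint p.
  by move=> Sx; rewrite rpredM ?rpredX // rpred_horner // rpredM // rpred_nat.
apply/eqm0P; exists (g.[t] + t ^+ d * (drop_poly d f).[p%:R * t]); last first.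
  by rewrite fE -mulrDr.
rewrite rpredD ?Sdx //; apply: (@pint_interpolation d 0) => //.
  rewrite (leq_trans (size_scale_leq _ _)) //.
  have [->|t0] := eqVneq (take_poly d f) 0; first by rewrite comp_poly0 size_poly0.
  rewrite (leq_trans (size_comp_poly_leq _ _)) //.
  rewrite size_scale // size_polyX muln1 prednK ?size_poly_gt0 //.
  exact: size_take_poly.
move=> m; rewrite add0n => /= md; have /eqm0P[z Sz e] := fm m md.
have -> : g.[m%:R] = z - m%:R ^+ d * (drop_poly d f).[p%:R * m%:R].
  apply: (mulfI (expf_neq0 d p0)); rewrite mulrBr -e fE; ring.
by rewrite rpredB ?Sdx ?rpred_nat.
Qed.

End Interpolation.

Section FiniteDifferences.
Variable R : comNzRingType.
Implicit Types f g s : nat -> R.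

Fixpoint fdiff i s m : R :=
  if i is i'.+1 then fdiff i' s m.+1 - fdiff i' s m else s m.

Lemma eq_fdiff i f g : f =1 g -> fdiff i f =1 fdiff i g.
Proof. by move=> fg; elim: i => [|i IHi] m //=; rewrite !IHi. Qed.

Lemma fdiffS i s m : fdiff i.+1 s m = fdiff i (fun m => s m.+1 - s m) m.
Proof.
elim: i m => // i IHi m; transitivity (fdiff i.+1 s m.+1 - fdiff i.+1 s m) => //.
by rewrite !IHi.
Qed.

Lemma fdiffD i f g m : fdiff i (fun m => f m + g m) m = fdiff i f m + fdiff i g m.
Proof. by elim: i m => //= i IHi m; rewrite !IHi; ring. Qed.

Lemma fdiff_shift i s m : fdiff i (fun m => s m.+1) m = fdiff i s m.+1.
Proof. by elim: i m => //= i IHi m; rewrite !IHi. Qed.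

Lemma newton_formula s m : s m = \sum_(i < m.+1) 'C(m, i)%:R * fdiff i s 0.
Proof.
elim: m s => [|m IHm] s; first by rewrite big_ord1 bin0 mul1r.
rewrite -[LHS]/((fun m => s m.+1) m) IHm.
under eq_bigr => i _ do
  rewrite fdiff_shift -(subrK (fdiff i s 0) (fdiff i s 1)) -/(fdiff i.+1 s 0) mulrDr.
rewrite big_split /= [in RHS]big_ord_recl bin0 mul1r.
under [in RHS]eq_bigr => i _ do rewrite lift0 binS natrD mulrDl.
have key : \sum_(i < m.+1) 'C(m, i)%:R * fdiff i s 0 =
    fdiff 0 s 0 + \sum_(i < m.+1) 'C(m, i.+1)%:R * fdiff i.+1 s 0.
  transitivity (\sum_(i < m.+2) 'C(m, i)%:R * fdiff i s 0).
    by rewrite [RHS]big_ord_recr /= bin_small // mul0r addr0.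
  by rewrite big_ord_recl bin0 mul1r.
by rewrite big_split key addrCA [X in _ + X]addrC.
Qed.

End FiniteDifferences.

Section Divided.
Variable p : nat.
Local Notation "x == y %[p^ n ]" := (eqm (pint p) (p%:R ^+ n) x y)
  (at level 70, y at next level, n at level 2).

Lemma eqm_le n m x y : (n <= m)%N -> x == y %[p^m] -> x == y %[p^n].
Proof.
move=> nm; rewrite -(subnK nm) addnC exprD; apply: eqm_dvd.
by rewrite rpredX ?rpred_nat.
Qed.

(* A sequence of the form m |-> f (p m), with f integral, is in the class for
   a = 0; the class for a consists of p^a times such sequences. *)
Definition pdivided a I (s : nat -> algC) :=
  forall i m, (i <= I)%N -> fdiff i s m == 0 %[p^(a + i)].

Lemma eq_pdivided a I f g : f =1 g -> pdivided a I f -> pdivided a I g.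
Proof. by move=> fg h i m iI; rewrite -(eq_fdiff i fg); apply: h. Qed.

Lemma pdividedD a I f g : pdivided a I f -> pdivided a I g ->
  pdivided a I (fun m => f m + g m).
Proof.
move=> hf hg i m iI; rewrite fdiffD -[X in eqm _ _ _ X]addr0.
by apply: eqmD; [apply: hf | apply: hg].
Qed.

Lemma pdivided_diff a I f : pdivided a I.+1 f ->
  pdivided a.+1 I (fun m => f m.+1 - f m).
Proof. by move=> hf i m iI; rewrite -fdiffS addSnnS; apply: hf. Qed.

Lemma pdivided_shift a I f : pdivided a I f -> pdivided a I (fun m => f m.+1).
Proof. by move=> hf i m iI; rewrite fdiff_shift; apply: hf. Qed.

Lemma pdivided_le a I J f : (J <= I)%N -> pdivided a I f -> pdivided a J f.
Proof. by move=> JI hf i m iJ; apply: hf; apply: leq_trans JI. Qed.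

(** Induction on [I] by the discrete Leibniz rule: taking a difference of one factor uses up one
    order and raises the class of that factor by one. *)
Lemma pdividedM a b I f g : pdivided a I f -> pdivided b I g ->
  pdivided (a + b) I (fun m => f m * g m).
Proof.
elim: I a b f g => [|I IHI] a b f g hf hg i m.
  rewrite leqn0 => /eqP -> /=; have := hf 0%N m isT; have := hg 0%N m isT.
  rewrite !addn0 /= => /eqm0P[z Sz ->] /eqm0P[w Sw ->].
  by apply/eqm0P; exists (w * z); rewrite ?rpredM // exprD; ring.
case: i => [_|i iI]; first by apply: (IHI); [apply: pdivided_le hf|apply: pdivided_le hg|].
rewrite fdiffS (eq_fdiff i (g := fun m => (f m.+1 - f m) * g m.+1 + f m * (g m.+1 - g m))).
  rewrite fdiffD -[X in eqm _ _ _ X]addr0 addnS -addSn; apply: eqmD.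
    rewrite -addSn; apply: IHI => //; first exact: pdivided_diff.
    by apply: pdivided_shift; apply: pdivided_le hg.
  rewrite -addnS; apply: IHI => //; last exact: pdivided_diff.
  exact: pdivided_le hf.
by move=> k; ring.
Qed.

Lemma fdiff0 (R : comNzRingType) i m : fdiff i (fun=> 0) m = 0 :> R.
Proof. by elim: i m => //= i IHi m; rewrite !IHi subrr. Qed.

Lemma pdivided_cst a I c : c \in pint p -> pdivided a I (fun=> p%:R ^+ a * c).
Proof.
move=> Sc [|i] m _; first by apply/eqm0P; exists c; rewrite ?addn0.
rewrite fdiffS (eq_fdiff i (g := fun=> 0)); last by move=> k; rewrite subrr.
by rewrite fdiff0; apply: eqm_refl.
Qed.

Lemma pdivided_bounded a I f : (forall m, f m == 0 %[p^(a + I)]) -> pdivided a I f.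
Proof.
move=> hf i m iI; apply: (@eqm_le _ (a + I)); first by rewrite leq_add2l.
elim: i m {iI} => //= i IHi m; rewrite -[X in eqm _ _ _ X](subrr 0).
exact: eqmB.
Qed.

Lemma pdivided_id I : pdivided 0 I (fun m => p%:R * m%:R).
Proof.
case=> [|i] m _; first by rewrite expr0; apply/eqm0P;
  exists (p%:R * m%:R); rewrite ?rpredM ?rpred_nat // mul1r.
rewrite fdiffS (eq_fdiff i (g := fun=> p%:R ^+ 1 * 1)).
  case: i => [|i]; first by apply/eqm0P; exists 1; rewrite ?rpred1.
  rewrite fdiffS (eq_fdiff i (g := fun=> 0)); last by move=> k; rewrite subrr.
  by rewrite fdiff0; apply: eqm_refl.
by move=> k; rewrite -natr1; ring.
Qed.

Lemma pdivided_horner I (B : {poly int}) :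
  pdivided 0 I (fun m => (map_poly intr B).[p%:R * m%:R]).
Proof.
elim/poly_ind: B => [|B c IHB].
  by move=> i m _; rewrite (eq_fdiff i (g := fun=> 0)) ?fdiff0;
    [exact: eqm_refl | move=> k; rewrite rmorph0 horner0].
apply: (@eq_pdivided _ _ (fun m =>
    (map_poly intr B).[p%:R * m%:R] * (p%:R * m%:R) + p%:R ^+ 0 * c%:~R)).
  move=> m; rewrite rmorphD rmorphM /= map_polyX map_polyC !hornerE /=; ring.
apply: pdividedD; last by apply: pdivided_cst; rewrite rpred_int.
by rewrite -[X in pdivided X](addn0 0%N); apply: pdividedM => //; apply: pdivided_id.
Qed.

End Divided.

(** * Wilson products: the p-adic Gamma function at the multiples of p *)

Lemma Fp_prod_XaddC p : prime p ->
  \prod_(1 <= k < p) ('X + (k%:R)%:P) = 'X^(p.-1) - 1 :> {poly 'F_p}.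
Proof.
move=> p_pr; pose rs : seq 'F_p := [seq - k%:R | k <- index_iota 1 p].
have p1 := prime_gt1 p_pr.
have srs : size rs = p.-1 by rewrite size_map size_iota subn1.
have sX : size ('X^(p.-1) - 1 : {poly 'F_p}) = p.-1.+1.
  by rewrite size_XnsubC //; lia.
have kp k : (k < p)%N -> (k%:R : 'F_p) = k :> nat by move=> kp; rewrite val_Fp_nat // modn_small.
have k0 k : (0 < k < p)%N -> k%:R != 0 :> 'F_p.
  by move=> /andP[k0 k1]; apply/eqP => /(congr1 (@nat_of_ord _)); rewrite kp //= => k00; lia.
have := @all_roots_prod_XsubC _ ('X^(p.-1) - 1) rs; rewrite srs => ->//.
- rewrite big_map (eqP (monicXnsubC _ _)) ?scale1r; last by lia.
  by apply: eq_bigr => k _; rewrite polyCN opprK.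
- apply/allP => x /mapP[k]; rewrite mem_index_iota => hk ->.
  have y0 : - k%:R != 0 :> 'F_p by rewrite oppr_eq0 k0.
  rewrite rootE !hornerE subr_eq0; apply/eqP/(mulfI y0).
  rewrite -exprS prednK ?mulr1; last by lia.
  by have := expf_card (- k%:R : 'F_p); rewrite card_Fp.
- rewrite uniq_rootsE map_inj_in_uniq ?iota_uniq //.
  move=> k l; rewrite !mem_index_iota => hk hl /oppr_inj /(congr1 (@nat_of_ord _)).
  by rewrite !kp //; lia.
Qed.

(** The ratio Gamma_p(x + p) / Gamma_p(x) for x divisible by p, when p is odd. *)
Definition wilson_fun (p : nat) (x : algC) := - \prod_(1 <= k < p) (k%:R + x).

(** By Fermat, the product of the X + k is X^(p-1) - 1 modulo p. The power of x is kept apart from p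
    B: as a polynomial it is not divisible by p, but at x = p m it vanishes modulo p^(p-1). This is
    what limits the precision to p - 1. *)
Lemma wilson_fun_expand p : prime p -> exists B : {poly int}, forall x,
  wilson_fun p x = 1 + p%:R * (map_poly intr B).[x] - x ^+ p.-1.
Proof.
move=> p_pr; pose W : {poly int} := \prod_(1 <= k < p) ('X + (k%:Z)%:P).
pose U := 'X^(p.-1) - 1 - W.
have dvdU i : (p%:Z %| U`_i)%Z.
  rewrite (dvdz_pcharf (pchar_Fp p_pr)) -coef_map rmorphB /= rmorph_prod.
  under eq_bigr do rewrite rmorphD /= map_polyX map_polyC /=.
  by rewrite Fp_prod_XaddC // rmorphB rmorph1 /= map_polyXn subrr coef0.
exists (map_poly (fun c => (c %/ p)%Z) U) => x.
have UE : U = p%:Z *: map_poly (fun c => (c %/ p)%Z) U.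
  by apply/polyP => i; rewrite coefZ coef_map_id0 ?div0z // mulrC divzK.
have -> : p%:R * (map_poly intr (map_poly (fun c => (c %/ p)%Z) U)).[x] =
    (map_poly intr U).[x].
  by rewrite [in RHS]UE -mul_polyC rmorphM /= map_polyC hornerM hornerC.
rewrite !rmorphB /= rmorph1 map_polyXn rmorph_prod !hornerE horner_prod.
rewrite /wilson_fun; under [in RHS]eq_bigr do
  rewrite rmorphD /= map_polyX map_polyC hornerD hornerX hornerC addrC.
set P := LHS; set Q := (X in _ - X - _).
have -> : P = - Q by [].
by rewrite /=; ring.
Qed.

Section WilsonProducts.
Variables (p : nat) (p_pr : prime p).
Local Notation "x == y %[p^ n ]" := (eqm (pint p) (p%:R ^+ n) x y)
  (at level 70, y at next level, n at level 2).

(* The value of the p-adic Gamma function at p m. *)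
Definition wilson_prod m := \prod_(i < m) wilson_fun p (p%:R * i%:R).

Lemma wilson_fun_pint x : x \in pint p -> wilson_fun p x \in pint p.
Proof.
by move=> Sx; rewrite rpredN rpred_prod // => k _; rewrite rpredD ?rpred_nat.
Qed.

Lemma wilson_prodS m :
  wilson_prod m.+1 = wilson_fun p (p%:R * m%:R) * wilson_prod m.
Proof. by rewrite [LHS]big_ord_recr [LHS]mulrC. Qed.

Lemma pdivided_wilson I : (I < p.-1)%N ->
  pdivided p 1 I (fun m => wilson_fun p (p%:R * m%:R) - 1).
Proof.
move=> Ip; have [B VE] := wilson_fun_expand p_pr.
apply: (@eq_pdivided _ _ _ (fun m => (p%:R ^+ 1 * 1) *
   (map_poly intr B).[p%:R * m%:R] + - (p%:R * m%:R) ^+ p.-1)).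
  by move=> m; rewrite VE; ring.
apply: pdividedD.
  rewrite -[X in pdivided _ X](addn0 1%N); apply: pdividedM.
    by apply: pdivided_cst; rewrite rpred1.
  exact: pdivided_horner.
apply: pdivided_bounded => m; apply: (@eqm_le _ _ p.-1); first by lia.
apply/eqm0P; exists (- m%:R ^+ p.-1); first by rewrite rpredN rpredX ?rpred_nat.
by rewrite exprMn mulrN.
Qed.

(** The difference of [wilson_prod] at m is [wilson_prod] itself times V(p m) - 1, with V =
    [wilson_fun p]. This factor is in class 1, so order [I] for the product gives order [I.+1]. *)
Lemma pdivided_wilson_prod I : (I <= p.-1)%N -> pdivided p 0 I wilson_prod.
Proof.
elim: I => [_|I IHI Ip]; first by apply: pdivided_bounded => m; rewrite expr0;
  apply/eqm0P; exists (wilson_prod m); rewrite ?mul1r // rpred_prod // => i _;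
  rewrite wilson_fun_pint ?rpredM ?rpred_nat.
case=> [|i] m iI.
  by apply: (pdivided_bounded (I := 0)) => // k; rewrite expr0;
  apply/eqm0P; exists (wilson_prod k); rewrite ?mul1r // rpred_prod // => i _;
  rewrite wilson_fun_pint ?rpredM ?rpred_nat.
rewrite fdiffS (eq_fdiff i
  (g := fun m => (wilson_fun p (p%:R * m%:R) - 1) * wilson_prod m)).
  rewrite addnS -addSn -(addn0 1%N); apply: (@pdividedM _ _ _ I) => //.
    exact: pdivided_wilson.
  by apply: IHI; apply: ltnW.
by move=> k; rewrite wilson_prodS; ring.
Qed.

Lemma pint_fact_inv i : (i < p)%N -> i`!%:R^-1 \in pint p.
Proof.
elim: i => [|i IHi] ip; first by rewrite invr1 rpred1.
by rewrite factS natrM invfM; apply: rpredM; [exact: pint_small_inv|apply/IHi/ltnW].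
Qed.

Lemma fdiff_wilson_prod d i m : (d <= p.-1)%N -> (d <= i)%N ->
  fdiff i wilson_prod m == 0 %[p^d].
Proof.
move=> dp /subnK <-; elim: (i - d)%N m => [|k IHk] m.
  exact: (pdivided_wilson_prod dp).
by rewrite addSn /= -[X in eqm _ _ _ X](subrr 0); apply: eqmB.
Qed.

(** [E] is the Newton interpolation polynomial at the nodes p j, j < d. Its coefficients are
    integral because p^i divides the i-th difference and i! is prime to p; the omitted terms involve
    differences of order at least d, which p^d divides. *)
Lemma wilson_interpolation d : (d <= p.-1)%N -> exists E : {poly algC},
  E \is a polyOver (pint p) /\
  forall m, E.[p%:R * m%:R] == wilson_prod m %[p^d].
Proof.
move=> dp; have p0 : p%:R != 0 :> algC by rewrite pnatr_eq0 -lt0n prime_gt0.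
have f0 i : i`!%:R != 0 :> algC by rewrite pnatr_eq0 -lt0n fact_gt0.
pose c i := fdiff i wilson_prod 0 / (p%:R ^+ i * i`!%:R).
pose N i : {poly algC} := \prod_(j < i) ('X - (p%:R * j%:R)%:P).
exists (\sum_(i < d) c i *: N i); split=> [|m].
  apply: rpred_sum => i _; apply: polyOverZ; last first.
    apply: rpred_prod => j _; rewrite polyOverXsubC rpredM ?rpred_nat //.
  have /(_ i 0%N) := pdivided_wilson_prod dp; case/(_ (ltnW (ltn_ord i)))/eqm0P.
  move=> z Sz; rewrite add0n /c => ->.
  have -> : p%:R ^+ i * z / (p%:R ^+ i * i`!%:R) = z * i`!%:R^-1.
    by field; rewrite f0 expf_neq0.
  by rewrite rpredM // pint_fact_inv //; have := ltn_ord i; lia.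
have NE i : (N i).[p%:R * m%:R] = p%:R ^+ i * i`!%:R * 'C(m, i)%:R.
  rewrite -mulrA -(natrM _ i`!) mulnC bin_ffact /N.
  elim: i => [|i IHi]; first by rewrite big_ord0 hornerC mul1r.
  rewrite big_ord_recr /= hornerM IHi hornerXsubC ffactnSr natrM exprSr.
  have [im|mi] := leqP i m; first by rewrite natrB //; ring.
  by rewrite ffact_small // !mul0r !mulr0 mul0r.
apply: eqm_sym.
rewrite (newton_formula wilson_prod m) horner_sum.
have sumE n : (m.+1 <= n)%N -> \sum_(i < m.+1) 'C(m, i)%:R * fdiff i wilson_prod 0 =
   \sum_(i < n) 'C(m, i)%:R * fdiff i wilson_prod 0.
  move=> mn; rewrite -(subnKC mn) big_split_ord /= [X in _ + X]big1 ?addr0 //.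
  by move=> i _; rewrite bin_small ?mul0r //; lia.
rewrite (sumE (d + m.+1)%N) ?leq_addl // big_split_ord /=.
rewrite -[X in eqm _ _ _ X]addr0; apply: eqmD.
  apply/eq_eqm/eq_bigr => i _; rewrite hornerZ NE /c.
  by rewrite mulrA divfK ?mulf_neq0 ?expf_neq0 // mulrC.
apply: eqm_sum0 => i _; rewrite -(mulr0 'C(m, d + i)%:R); apply: eqmMl.
  exact: rpred_nat.
by apply: fdiff_wilson_prod; rewrite ?leq_addr.
Qed.

End WilsonProducts.

(** * The p-adic Gamma function near 0 as a polynomial *)

Section LowProd.
Variables (p : nat) (p_pr : prime p) (n : nat) (np : (n < p)%N).

Definition low_prod (x : algC) := \prod_(1 <= k < n.+1) (k%:R + x).

Let coprime_low k : (0 < k < n.+1)%N -> coprimez k p.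
Proof.
move=> hk; rewrite coprimez_sym /coprimez /gcdz /=.
by rewrite eqz_nat -/(coprime _ _) prime_coprime // gtnNdvd //; lia.
Qed.

Lemma low_prod_unit t : t \in pint p -> (low_prod (p%:R * t))^-1 \in pint p.
Proof.
move=> St; rewrite /low_prod -prodfV big_seq rpred_prod // => k.
rewrite mem_index_iota => hk; apply: (@pint_unit p k) => //; exact: coprime_low.
Qed.

Lemma low_prod_neq0 t : t \in pint p -> low_prod (p%:R * t) != 0.
Proof.
move=> St; rewrite /low_prod prodf_seq_neq0; apply/allP => k.
rewrite mem_index_iota /= => hk; apply: (@pint_eqm_neq0 p k) => //.
  exact: coprime_low.
by exists t => //; rewrite -[k%:~R]/(k%:R); ring.
Qed.

Lemma low_prod_horner : exists f : {poly algC},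
  f \is a polyOver (pint p) /\ forall u, f.[u] = low_prod u.
Proof.
exists (\prod_(1 <= k < n.+1) ((k%:R)%:P + 'X)); split.
  by rewrite rpred_prod // => k _; rewrite rpredD ?polyOverX ?polyOverC ?rpred_nat.
by move=> u; rewrite horner_prod; apply: eq_bigr => k _; rewrite !hornerE.
Qed.

End LowProd.

Section GammaPolynomial.
Variables (p : nat) (p_pr : prime p) (p_odd : odd p).
Local Notation "x == y %[p^ n ]" := (eqm (pint p) (p%:R ^+ n) x y)
  (at level 70, y at next level, n at level 2).
Local Notation V := (wilson_fun p).

Let p0 : p%:R != 0 :> algC.
Proof. by rewrite pnatr_eq0 -lt0n prime_gt0. Qed.

Lemma wilson_fun_sym x : V (- p%:R - x) = V x.
Proof.
rewrite /V big_nat_rev; congr (- _).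
rewrite (@eq_big_nat _ _ _ _ _ _ (fun k => -1 * (k%:R + x))) => [|k hk].
  rewrite big_split /= big_const_nat iter_mulr_1 subn1.
  rewrite -signr_odd; have -> : odd p.-1 = false by have := prime_gt1 p_pr; lia.
  by rewrite mul1r.
rewrite add1n subSS natrB; last by lia.
by ring.
Qed.

Let p_eqm1 w : w \in pint p -> eqm (pint p) p%:R (1 + p%:R * w) 1%:~R.
Proof. by move=> Sw; exists w => //; ring. Qed.

Let c1 : coprimez 1 p. Proof. by rewrite /coprimez gcd1z. Qed.

Lemma wilson_fun_eqm1 t : t \in pint p -> eqm (pint p) p%:R (V (p%:R * t)) 1%:~R.
Proof.
move=> St; have [B ->] := wilson_fun_expand p_pr.
have SB : (map_poly intr B).[p%:R * t] \in pint p.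
  rewrite rpred_horner ?rpredM ?rpred_nat //.
  by apply/polyOverP => i; rewrite coef_map rpred_int.
have p2 := prime_gt1 p_pr.
have -> : (p%:R * t) ^+ p.-1 = p%:R * (p%:R ^+ p.-2 * t ^+ p.-1).
  by rewrite exprMn; case: p p2 => [|[|q]] //= _; rewrite exprS mulrA.
rewrite -addrA -mulrBr; apply: p_eqm1.
by rewrite rpredB ?rpredM ?rpredX ?rpred_nat.
Qed.

Variables (d : nat) (E : {poly algC}).
Hypotheses (dp : (d <= p.-1)%N) (SE : E \is a polyOver (pint p)).
Hypothesis EM : forall m, E.[p%:R * m%:R] == wilson_prod p m %[p^d].

Let Spd : p%:R ^+ d \in pint p.
Proof. by rewrite rpredX ?rpred_nat. Qed.

Lemma gamma_poly_pint x : x \in pint p -> E.[x] \in pint p.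
Proof. exact: rpred_horner. Qed.

Let mulp_pint t : t \in pint p -> p%:R * t \in pint p.
Proof. by move=> St; rewrite rpredM ?rpred_nat. Qed.

Lemma gamma_poly0 : E.[0] == 1 %[p^d].
Proof. by have := EM 0; rewrite mulr0 /wilson_prod big_ord0. Qed.

(** At t = m this is the recursion of [wilson_prod]; interpolation extends it to all integral t, in
    particular to negative integers and to non-rational t. *)
Lemma gamma_polyS t : t \in pint p ->
  E.[p%:R * t + p%:R] == V (p%:R * t) * E.[p%:R * t] %[p^d].
Proof.
move=> St; pose VX : {poly algC} := - \prod_(1 <= k < p) ((k%:R)%:P + 'X).
have VXE x : VX.[x] = V x.
  rewrite hornerN horner_prod; congr (- _).
  by apply: eq_bigr => k _; rewrite !hornerE.
have SVX : VX \is a polyOver (pint p).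
  rewrite rpredN rpred_prod // => k _.
  by rewrite rpredD ?polyOverX ?polyOverC ?rpred_nat.
pose f := (E \Po ('X + (p%:R)%:P)) - VX * E.
have fE x : f.[x] = E.[x + p%:R] - V x * E.[x].
  by rewrite /f hornerD hornerN hornerM VXE horner_comp !hornerE.
apply/sub0_eqm; rewrite -fE; apply: eqm_interpolation => //; first by lia.
  rewrite rpredB ?rpredM // polyOver_comp // rpredD ?polyOverX ?polyOverC //.
  by rewrite rpred_nat.
move=> m _; rewrite fE; apply/eqm_sub0.
have -> : p%:R * m%:R + p%:R = p%:R * m.+1%:R :> algC by rewrite -natr1; ring.
apply: eqm_trans (EM _) _; rewrite wilson_prodS; apply: eqmMl.
  by rewrite wilson_fun_pint ?mulp_pint ?rpred_nat.
exact: eqm_sym.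
Qed.

(** The reflection formula near 0. At x = p m it follows by induction: going from x to x + p
    multiplies by V(x), and going from - x to - x - p divides by V(- p - x) = V(x). *)
Lemma gamma_polyN t : t \in pint p ->
  E.[p%:R * t] * E.[- (p%:R * t)] == 1 %[p^d].
Proof.
move=> St; pose f := E * (E \Po (- 'X)) - 1.
have fE x : f.[x] = E.[x] * E.[- x] - 1.
  by rewrite /f !hornerE horner_comp !hornerE.
apply/sub0_eqm; rewrite -fE; apply: eqm_interpolation => //; first by lia.
  by rewrite rpredB ?rpred1 // rpredM // polyOver_comp // rpredN polyOverX.
move=> m _; rewrite fE; apply/eqm_sub0; elim: m => [|m IHm].
  rewrite mulr0 oppr0 -[X in eqm _ _ _ X](mulr1 1).
  by apply: eqmM; rewrite ?rpred1 //; apply: gamma_poly0.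
set x := p%:R * m%:R in IHm; have Sx : x \in pint p by rewrite mulp_pint ?rpred_nat.
have xS : p%:R * m.+1%:R = x + p%:R :> algC by rewrite /x -natr1; ring.
have xN : - x = p%:R * (- m%:R - 1) + p%:R by rewrite /x; ring.
have xN' : - (x + p%:R) = p%:R * (- m%:R - 1) by rewrite /x; ring.
have SV : V x \in pint p by rewrite wilson_fun_pint.
have UV : (V x)^-1 \in pint p.
  by apply: pint_eqm_unit c1 (wilson_fun_eqm1 _); rewrite rpred_nat.
have V0 : V x != 0.
  by apply: pint_eqm_neq0 c1 (wilson_fun_eqm1 _); rewrite ?rpred_nat.
rewrite xS; set y := E.[_]; set z := E.[_].
have Sy : y \in pint p by rewrite gamma_poly_pint // rpredD ?rpred_nat.
have h1 : y == V x * E.[x] %[p^d] by apply: gamma_polyS; rewrite rpred_nat.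
have h2 : E.[- x] == V x * z %[p^d].
  have := @gamma_polyS (- m%:R - 1); rewrite -xN -xN' rpredB ?rpredN ?rpred1 ?rpred_nat //.
  by rewrite opprD addrC wilson_fun_sym [- p%:R - x]addrC -opprD; apply.
have -> : y * z = (V x)^-1 * (y * (V x * z)) by field.
rewrite -[X in eqm _ _ _ X](mulVf V0); apply: eqmMl => //.
apply: eqm_trans (eqmMl Sy (eqm_sym h2)) _.
apply: eqm_trans (eqmMr _ h1) _; first by rewrite gamma_poly_pint ?rpredN.
by rewrite -mulrA -[X in eqm _ _ _ X]mulr1; apply: eqmMl.
Qed.

Variables (r n : nat).
Hypotheses (rn : (3 * n + 1 = r * p)%N) (r12 : (r == 1%N) || (r == 2%N)).

Definition mid_prod (x : algC) := \prod_(n.+1 <= k < (2 * n).+1 | ~~ (p %| k)%N) (k%:R + x).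

Let np : (n < p)%N. Proof. by nia. Qed.

(** As r p = 3 n + 1, the integers from 1 to r p - 1 form three blocks of length n, and k -> r p - k
    carries the third block to the first. *)
Lemma mid_prodE x : (-1) ^+ n * (low_prod n x * mid_prod x * low_prod n (- (r * p)%:R - x)) =
   \prod_(1 <= k < r * p | ~~ (p %| k)%N) (k%:R + x).
Proof.
rewrite (@big_cat_nat _ _ _ n.+1) //=; last by lia.
rewrite (@big_cat_nat _ _ _ (2 * n).+1 n.+1) //=; [|lia|lia].
have -> : \prod_(1 <= k < n.+1 | ~~ (p %| k)%N) (k%:R + x) = low_prod n x.
  rewrite /low_prod [RHS]big_nat big_nat_cond; apply: eq_bigl => k.
  by case: (boolP (_ <= _ < _)%N) => //= hk; rewrite gtnNdvd //; lia.
have -> : \prod_((2 * n).+1 <= k < r * p | ~~ (p %| k)%N) (k%:R + x) =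
    (-1) ^+ n * low_prod n (- (r * p)%:R - x).
  rewrite /low_prod big_nat_rev.
  have -> : (-1) ^+ n = \prod_(1 <= k < n.+1) (-1) :> algC.
    by rewrite big_const_nat iter_mulr_1 subn1.
  rewrite -big_split /= -add1n big_addn; have -> : (r * p - 2 * n = n.+1)%N by lia.
  rewrite big_nat_cond [RHS]big_nat; apply: eq_big => [k|k /andP[hk _]].
    case: (boolP (_ <= _ < _)%N) => //= hk.
    have -> : (1 + 2 * n + r * p - (k + 2 * n).+1 = r * p - k)%N by lia.
    rewrite dvdn_subr ?dvdn_mull //; last by lia.
    by rewrite gtnNdvd //; lia.
  have -> : (1 + 2 * n + r * p - (k + 2 * n).+1 = r * p - k)%N by lia.
  by rewrite natrB; [ring | lia].
by rewrite /mid_prod; ring.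
Qed.

Lemma gamma_poly_shift t : t \in pint p ->
  (-1) ^+ r * E.[p%:R * t + (r * p)%:R] ==
  (\prod_(1 <= k < r * p | ~~ (p %| k)%N) (k%:R + p%:R * t)) * E.[p%:R * t] %[p^d].
Proof.
move=> St; have p1 := prime_gt1 p_pr.
have e1 y : \prod_(1 <= k < p | ~~ (p %| k)%N) (k%:R + y) = - V y.
  rewrite opprK [RHS]big_nat big_nat_cond; apply: eq_bigl => k.
  by case: (boolP (_ <= _ < _)%N) => //= hk; rewrite gtnNdvd //; lia.
case/orP: r12 => /eqP ->.
  rewrite mul1n expr1 e1 mulN1r [X in eqm _ _ _ X]mulNr; apply: eqmN.
  exact: gamma_polyS.
have -> : \prod_(1 <= k < 2 * p | ~~ (p %| k)%N) (k%:R + p%:R * t) =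
    V (p%:R * t) * V (p%:R * t + p%:R).
  rewrite (@big_cat_nat _ _ _ p) //=; [|lia|lia].
  rewrite e1 big_ltn_cond ?dvdnn /=; last by lia.
  rewrite -add1n -[X in \prod_(X <= _ < _ | _) _]/(1 + p)%N big_addn.
  rewrite (_ : 2 * p - p = p)%N; last by lia.
  rewrite -[LHS]mulrNN opprK; congr (_ * _).
  rewrite -[RHS]opprK -e1; congr (- _); apply: eq_big => k.
    by rewrite dvdn_addl.
  by move=> _; rewrite natrD; ring.
rewrite expr2 mulrNN !mul1r.
have -> : p%:R * t + (2 * p)%:R = p%:R * (t + 1) + p%:R by rewrite natrM; ring.
have S1 : t + 1 \in pint p by rewrite rpredD ?rpred1.
apply: eqm_trans (gamma_polyS S1) _.
have -> : p%:R * (t + 1) = p%:R * t + p%:R by ring.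
rewrite [X in eqm _ _ _ X](_ : _ = V (p%:R * t + p%:R) *
  (V (p%:R * t) * E.[p%:R * t])); last by ring.
apply: eqmMl; last exact: gamma_polyS.
by rewrite wilson_fun_pint // rpredD ?mulp_pint ?rpred_nat.
Qed.

(* Up to sign, [h x] is the value of the p-adic Gamma function at n + 1 + x. *)
Lemma mid_prod_eqm x t : t \in pint p -> x = p%:R * t ->
  let h y := E.[y] * low_prod n y in
  mid_prod x * (h x * h (- (r * p)%:R - x)) == - 1 %[p^d].
Proof.
move=> St xE h; have := gamma_poly_shift St; rewrite -xE => e.
have Sx : x \in pint p by rewrite xE mulp_pint.
pose t' := - t - r%:R; have St' : t' \in pint p by rewrite rpredB ?rpredN ?rpred_nat.
have x'E : - (r * p)%:R - x = p%:R * t' by rewrite xE natrM /t'; ring.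
have nr : odd n = ~~ odd r by have := congr1 odd rn; rewrite oddD !oddM p_odd; lia.
set x' := - _ - x; rewrite -/x' in x'E.
have Sx' : E.[x'] \in pint p by rewrite gamma_poly_pint // x'E mulp_pint.
have -> : mid_prod x * (h x * h x') = (-1) ^+ n * E.[x'] *
    ((\prod_(1 <= k < r * p | ~~ (p %| k)%N) (k%:R + x)) * E.[x]).
  rewrite -mid_prodE -/x' /h; set s := (-1) ^+ n.
  have : s * s = 1 by rewrite /s -expr2 sqrr_sign.
  move=> ss; rewrite -[LHS]mul1r -ss; ring.
have := eqmMl (x := (-1) ^+ n * E.[x']) _ (eqm_sym e).
rewrite rpredM ?rpredX ?rpredN1 // => /(_ isT) {}e; apply: eqm_trans e _.
have -> : x + (r * p)%:R = - x' by rewrite /x'; ring.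
have -> : (-1) ^+ n * E.[x'] * ((-1) ^+ r * E.[- x']) = - 1 * (E.[x'] * E.[- x']).
  have -> : (-1) ^+ n = - (-1) ^+ r :> algC.
    by rewrite -signr_odd nr signrN signr_odd.
  set s := (-1) ^+ r; have : s * s = 1 by rewrite /s -expr2 sqrr_sign.
  move=> ss; rewrite -[- 1 in RHS]/(- (1)) -ss; ring.
rewrite x'E -[X in eqm _ _ _ X]mulr1; apply: eqmMl; first by rewrite rpredN1.
exact: gamma_polyN.
Qed.

End GammaPolynomial.

(** * The Gamma quotient *)

Section FifthRootAlgebra.
Variable z : algC.
Hypothesis zP : 5.-primitive_root z.

Lemma root5_sum : 1 + z + z ^+ 2 + z ^+ 3 + z ^+ 4 = 0.
Proof.
have z1 : z - 1 != 0.
  rewrite subr_eq0; apply: contraTneq isT => z1.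
  by have := prim_order_dvd zP 1; rewrite expr1 z1 eqxx.
apply: (mulfI z1); rewrite mulr0; transitivity (z ^+ 5 - 1); first by ring.
by rewrite (prim_expr_order zP) subrr.
Qed.

(** Complex conjugate factors are multiplied first. The two quadratics have middle coefficients s
    and - 1 - s with s = z + z^4, whose product is - 1. *)
Lemma root5_prod q y : (q + y) * (q + z * y) * (q + z ^+ 2 * y) *
  (q + z ^+ 3 * y) * (q + z ^+ 4 * y) = q ^+ 5 + y ^+ 5.
Proof.
have z5 := prim_expr_order zP; pose s := z + z ^+ 4.
have e1 : (q + z * y) * (q + z ^+ 4 * y) = q ^+ 2 + s * q * y + y ^+ 2.
  transitivity (q ^+ 2 + s * q * y + z ^+ 5 * y ^+ 2); first by rewrite /s; ring.
  by rewrite z5 mul1r.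
have s' : z ^+ 2 + z ^+ 3 = -1 - s.
  by apply/eqP; rewrite -subr_eq0 -root5_sum /s; apply/eqP; ring.
have e2 : (q + z ^+ 2 * y) * (q + z ^+ 3 * y) = q ^+ 2 + (-1 - s) * q * y + y ^+ 2.
  transitivity (q ^+ 2 + (z ^+ 2 + z ^+ 3) * q * y + z ^+ 5 * y ^+ 2); first by ring.
  by rewrite z5 mul1r s'.
have ss : s * (-1 - s) = -1.
  rewrite -s'; transitivity (z ^+ 3 + z ^+ 4 + z ^+ 5 * (z + z ^+ 2)).
    by rewrite /s; ring.
  by rewrite z5 mul1r; apply/eqP; rewrite -subr_eq0 -root5_sum; apply/eqP; ring.
transitivity ((q + y) * ((q + z * y) * (q + z ^+ 4 * y)) *
  ((q + z ^+ 2 * y) * (q + z ^+ 3 * y))); first by ring.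
rewrite e1 e2; transitivity ((q + y) * ((q ^+ 2 + y ^+ 2) ^+ 2 - q * y * (q ^+ 2 + y ^+ 2)
  + s * (-1 - s) * (q * y) ^+ 2)); first by ring.
by rewrite ss; ring.
Qed.

(** A rational, hence real, fifth root of unity is 1. Irrationality will keep the denominators in
    Dougall's formula away from 0. *)
Lemma root5_irrational i : ~~ (5 %| i)%N -> z ^+ i \notin Crat.
Proof.
move=> i5; apply: contra i5 => Rz; rewrite (prim_order_dvd zP).
have e : (z ^+ i) ^+ 5 = 1 by rewrite exprAC (prim_expr_order zP) expr1n.
have rz : z ^+ i \is Num.real by apply: Creal_Crat.
case/orP: (rz) => h; first by rewrite -(pexpr_eq1 (n := 5)) ?e.
have := h; rewrite -oppr_ge0 => h'; have := exprn_ge0 5 h'.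
by rewrite exprNn e mulr1 -signr_odd /= expr1 oppr_ge0 ler10.
Qed.

End FifthRootAlgebra.

Lemma coef_comp_scaleX (R : comNzRingType) (f : {poly R}) c i :
  (f \Po (c *: 'X))`_i = f`_i * c ^+ i.
Proof.
have -> : f \Po (c *: 'X) = \poly_(j < size f) (f`_j * c ^+ j).
  rewrite comp_polyE poly_def; apply: eq_bigr => j _.
  by rewrite exprZn scalerA.
by rewrite coef_poly; case: ltnP => // h; rewrite nth_default ?mul0r.
Qed.

Section FifthRoot.
Variables (p : nat) (p_pr : prime p) (z : algC).
Hypothesis zP : 5.-primitive_root z.
Local Notation "x == y %[p^ n ]" := (eqm (pint p) (p%:R ^+ n) x y)
  (at level 70, y at next level, n at level 2).

Lemma root5_pint : z \in pint p.
Proof. exact: Aint_pint (Aint_prim_root zP). Qed.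

(** As a polynomial in x, the product of the f(z^i x) is invariant under x -> z x, so its
    coefficients of degree 1 to 4 vanish; what remains beyond the constant term is a multiple of (p
    t)^5. *)
Lemma prod_root5_eqm d (f : {poly algC}) t : (d <= 5)%N ->
  f \is a polyOver (pint p) -> t \in pint p ->
  \prod_(i < 5) f.[z ^+ i * (p%:R * t)] == f.[0] ^+ 5 %[p^d].
Proof.
move=> d5 Sf St; apply: (eqm_le d5).
pose g := \prod_(i < 5) (f \Po (z ^+ i *: 'X)).
have gE x : g.[x] = \prod_(i < 5) f.[z ^+ i * x].
  by rewrite horner_prod; apply: eq_bigr => i _; rewrite horner_comp !hornerE.
have Sg : g \is a polyOver (pint p).
  apply: rpred_prod => i _; apply: polyOver_comp => //.
  by rewrite polyOverZ ?polyOverX ?rpredX ?root5_pint.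
have gz : g \Po (z *: 'X) = g.
  transitivity (\prod_(i < 5) (f \Po (z ^+ i.+1 *: 'X))).
    rewrite /g rmorph_prod; apply: eq_bigr => i _ /=.
    by rewrite -comp_polyA comp_polyZ comp_polyX scalerA exprSr.
  rewrite big_ord_recr [RHS]big_ord_recl mulrC /= (prim_expr_order zP).
  by congr (_ * _).
have g0 i : (0 < i < 5)%N -> g`_i = 0.
  move=> hi; have := coef_comp_scaleX g z i; rewrite gz => /eqP.
  rewrite -{1}[g`_i]mulr1 -subr_eq0 -mulrBr mulf_eq0 => /orP[/eqP -> //|].
  rewrite subr_eq0 eq_sym -(prim_order_dvd zP) => /dvdnP[q qE]; lia.
rewrite -gE; have -> : f.[0] ^+ 5 = g.[0].
  by rewrite gE !big_ord_recr big_ord0 /= !mulr0; ring.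
have gx u : g.[u] = (drop_poly 5 g).[u] * u ^+ 5 + g`_0.
  rewrite -{1}(poly_take_drop 5 g) hornerD hornerM hornerXn addrC; congr (_ + _).
  rewrite -[RHS](hornerC _ u); congr (_.[_]); apply/polyP => i.
  rewrite coef_take_poly coefC.
  by case: i => [|i] //; case: ltnP => // hi; rewrite g0.
apply: sub0_eqm; apply/eqm0P.
exists ((drop_poly 5 g).[p%:R * t] * t ^+ 5); last by rewrite !gx; ring.
rewrite rpredM ?rpredX // rpred_horner ?rpredM ?rpred_nat //.
by apply/polyOverP => i; rewrite coef_drop_poly; apply: (polyOverP Sg).
Qed.

End FifthRoot.

Section GammaNat.
Variables (p : nat) (p_pr : prime p).

Definition gamma_nat N : algC :=
  (-1) ^+ N * \prod_(1 <= j < N | ~~ (p %| j)%N) j%:R.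

Lemma gamma_natS N : (0 < N)%N -> ~~ (p %| N)%N ->
  gamma_nat N.+1 = gamma_nat N * - N%:R.
Proof.
by move=> N0 pN; rewrite /gamma_nat big_mkcond big_nat_recr //= -big_mkcond pN exprS; ring.
Qed.

Lemma wilson_prodE m : odd p -> wilson_prod p m = gamma_nat (p * m).
Proof.
move=> p_odd; have p0 := prime_gt0 p_pr.
have prod0 N : \prod_(1 <= j < N | ~~ (p %| j)%N) j%:R =
    \prod_(0 <= j < N | ~~ (p %| j)%N) j%:R :> algC.
  by case: N => [|N]; [rewrite !big_geq | rewrite [RHS]big_ltn_cond ?dvdn0].
elim: m => [|m IHm].
  by rewrite muln0 /wilson_prod big_ord0 /gamma_nat big_geq // mulr1.
rewrite wilson_prodS IHm /gamma_nat !prod0 mulnS [(p + _)%N]addnC.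
rewrite [in RHS](@big_cat_nat _ _ _ (p * m)) ?leq_addr //=.
rewrite exprD -[(-1) ^+ p]signr_odd p_odd expr1.
have -> : \prod_(p * m <= j < p * m + p | ~~ (p %| j)%N) j%:R =
    \prod_(1 <= k < p) (k%:R + p%:R * m%:R) :> algC.
  rewrite -[X in \prod_(X <= _ < _ | _) _]add0n big_addn addKn.
  rewrite big_ltn_cond // add0n dvdn_mulr //=.
  rewrite big_nat_cond [RHS]big_nat; apply: eq_big => [k|k _].
    case: (boolP (_ <= _ < _)%N) => //= hk.
    by rewrite dvdn_addl ?dvdn_mulr // gtnNdvd //; lia.
  by rewrite natrD natrM.
by rewrite /wilson_fun; ring.
Qed.

Lemma gamma_nat_low m n : (0 < m)%N -> (n < p)%N ->
  gamma_nat (p * m - n) * low_prod n (- (p%:R * m%:R)) = gamma_nat (p * m).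
Proof.
move=> m0; elim: n => [|n IHn] np.
  by rewrite subn0 /low_prod big_geq // mulr1.
rewrite -IHn; last exact: ltnW.
have pm : (p <= p * m)%N by rewrite leq_pmulr.
have -> : (p * m - n = (p * m - n.+1).+1)%N by lia.
rewrite gamma_natS; [|lia|].
  rewrite /low_prod [in LHS]big_nat_recr //= natrB; last by lia.
  by rewrite natrM; ring.
by rewrite dvdn_subr ?dvdn_mulr //; [rewrite gtnNdvd | lia].
Qed.

End GammaNat.

Section GammaQuotient.
Variables (p : nat) (p_pr : prime p) (p_odd : odd p).
Local Notation "x == y %[p^ n ]" := (eqm (pint p) (p%:R ^+ n) x y)
  (at level 70, y at next level, n at level 2).
Variables (d r n : nat) (z : algC).
Hypotheses (d5 : (d <= 5)%N) (dp : (d <= p.-1)%N).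
Hypotheses (rn : (3 * n + 1 = r * p)%N) (r12 : (r == 1%N) || (r == 2%N)).
Hypothesis zP : 5.-primitive_root z.
Hypothesis p3 : coprime 3 p.

Let y : algC := - (r * p)%:R / 3%:R.
Let x i := z ^+ i * y.

(* The product side of Dougall's formula, without its factors divisible by p. *)
Definition gamma_quotient :=
  low_prod n y * (mid_prod p n (y - x 1 - x 2) *
    mid_prod p n (y - x 1 - x 3) * mid_prod p n (y - x 2 - x 3)) /
  (low_prod n (- x 1) * low_prod n (- x 2) *
   low_prod n (- x 3) * low_prod n (- x 4)).

Let t : algC := - r%:R / 3%:R.
Let yE : y = p%:R * t.
Proof. by rewrite /y /t natrM; field. Qed.
Let St : t \in pint p.
Proof. by rewrite rpredM ?rpredN ?rpred_nat // pint_nat_inv. Qed.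
Let Sz : z \in pint p. Proof. exact: root5_pint zP. Qed.

Let rpE : - (r * p)%:R = 3%:R * y :> algC.
Proof. by rewrite /y; field. Qed.

Let np : (n < p)%N. Proof. by nia. Qed.

Let xE i : x i = p%:R * (z ^+ i * t).
Proof. by rewrite /x yE; ring. Qed.

Let Szt i : z ^+ i * t \in pint p. Proof. by rewrite rpredM ?rpredX. Qed.

Let Sx i : x i \in pint p. Proof. by rewrite xE rpredM ?rpred_nat. Qed.

Let Sy : y \in pint p. Proof. by rewrite yE rpredM ?rpred_nat. Qed.

Let NxE i : - x i = p%:R * (- (z ^+ i * t)). Proof. by rewrite xE; ring. Qed.

Let low_x0 i : low_prod n (- x i) != 0.
Proof. by rewrite NxE; apply: (low_prod_neq0 p_pr np); rewrite rpredN. Qed.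

Lemma gamma_quotient_pint : gamma_quotient \in pint p.
Proof.
have low u : u \in pint p -> low_prod n u \in pint p.
  by move=> Su; rewrite rpred_prod // => k _; rewrite rpredD ?rpred_nat.
have mid u : u \in pint p -> mid_prod p n u \in pint p.
  by move=> Su; rewrite rpred_prod // => k _; rewrite rpredD ?rpred_nat.
have inv i : (low_prod n (- x i))^-1 \in pint p.
  by rewrite NxE; apply: (low_prod_unit p_pr np); rewrite rpredN.
rewrite /gamma_quotient !invfM.
have [i1 i2 i3 i4] := And4 (inv 1) (inv 2) (inv 3) (inv 4).
have l := low y Sy.
have m i j : mid_prod p n (y - x i - x j) \in pint p by rewrite mid ?rpredB.
have [m1 m2 m3] := And3 (m 1 2) (m 1 3) (m 2 3).
by repeat apply: rpredM.
Qed.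

(** The integer [m] replaces r / 3: since r p / 3 - n = 1 / 3, the integer p m - n approximates 1 /
    3 to precision p^d, and the right side is the value announced for Gamma_p(1/3). *)
Lemma gamma_quotient_eqm m : (0 < m)%N -> p%:R * m%:R == - y %[p^d] ->
  gamma_quotient == - gamma_nat p (p * m - n) ^+ 9 %[p^d].
Proof.
move=> m0 hm; have [E [SE EM]] := wilson_interpolation p_pr dp.
pose h u := E.[u] * low_prod n u.
have [L [SL LE]] := low_prod_horner p n.
have Spd : p%:R ^+ d \in pint p by rewrite rpredX ?rpred_nat.
have SEx u : u \in pint p -> E.[u] \in pint p by exact: gamma_poly_pint.
have SNx u : u \in pint p -> low_prod n u \in pint p.
  by move=> Su; rewrite -LE rpred_horner.
have Shx u : u \in pint p -> h u \in pint p by move=> Su; rewrite rpredM ?SEx ?SNx.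
pose G := gamma_nat p (p * m - n); pose h0 := h y.
have Sh0 : h0 \in pint p by exact: Shx.
have SG : G \in pint p.
  by rewrite rpredM ?rpredX ?rpredN1 // rpred_prod // => j _; rewrite rpred_nat.
have GN : G * low_prod n y == E.[- y] %[p^d].
  apply: (@eqm_trans _ _ _ E.[p%:R * m%:R]); last first.
    by apply: eqm_horner; rewrite ?rpredN.
  apply: eqm_trans (eqm_sym (EM m)); rewrite wilson_prodE // -(gamma_nat_low p_pr m0 np).
  apply: eqmMl => //; rewrite -!LE; apply: eqm_horner => //.
    by rewrite rpredN rpredM ?rpred_nat.
  by rewrite -[y]opprK; apply: eqmN; apply: eqm_sym.
have EN : E.[y] * E.[- y] == 1 %[p^d].
  by have := gamma_polyN p_pr p_odd dp SE EM St; rewrite -yE.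
(* Up to sign [h0] is Gamma_p(2/3), as n + 1 + y = 2 / 3; this is the reflection formula between 1 /
   3 and 2 / 3. *)
have Gh : G * h0 == 1 %[p^d].
  apply: eqm_trans EN; rewrite /h0 /h mulrCA; apply: eqmMl => //; exact: SEx.
have x0 : x 0 = y by rewrite /x expr0 mul1r.
have x5 i : x (5 + i) = x i by rewrite /x exprD (prim_expr_order zP) mul1r.
pose H6 := h (y - x 1 - x 2) * h (y - x 3 - x 4) *
  (h (y - x 1 - x 3) * h (y - x 2 - x 4)) * (h (y - x 2 - x 3) * h (y - x 1 - x 4)).
(* The factors on the left are [h (y - x i - x j)] for the ten pairs of indices modulo 5, which form
   two orbits under rotation, {i, i + 1} and {i, i + 2}. Each orbit has product [h0 ^+ 5] by
   symmetrization. The four pairs that contain 0 give [h (- x i)], because [x 0 = y]. *)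
have ten : H6 * (h (- x 1) * h (- x 2) * h (- x 3) * h (- x 4)) == h0 ^+ 10 %[p^d].
  pose H := (E * L) \Po ('X + y%:P).
  have SH : H \is a polyOver (pint p).
    by rewrite polyOver_comp ?rpredM // rpredD ?polyOverX ?polyOverC.
  pose F j := H \Po (- (1 + z ^+ j) *: 'X).
  have SF j : F j \is a polyOver (pint p).
    rewrite polyOver_comp // polyOverZ ?polyOverX // rpredN rpredD ?rpred1 //.
    exact: rpredX.
  have FE j u : (F j).[u] = h (y - u - z ^+ j * u).
    rewrite /F /H !horner_comp !hornerE LE -/(h _) ; congr (h _); ring.
  have F5 j := prod_root5_eqm p_pr zP d5 (SF j) St.
  have := eqmM Spd _ _ (F5 1%N) (F5 2%N); rewrite !FE !mulr0 !subr0 -/h0 -exprD.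
  rewrite rpredX // => /(_ isT isT); apply: eqm_trans; apply: eq_eqm.
  have xs i j : y - z ^+ i * (p%:R * t) - z ^+ j * (z ^+ i * (p%:R * t)) = y - x i - x (j + i).
    by rewrite -yE mulrA -exprD.
  rewrite !big_ord_recr !big_ord0 /= !FE !xs.
  rewrite -[(1 + 4)%N]/(5 + 0)%N -[(2 + 3)%N]/(5 + 0)%N -[(2 + 4)%N]/(5 + 1)%N !x5 x0.
  have e1 i : y - x i - y = - x i by ring.
  have e2 i : y - y - x i = - x i by ring.
  have e3 i j : y - x i - x j = y - x j - x i by ring.
  rewrite !e1 !e2 (e3 4 1) /= /H6; ring.
(* The product over all five indices is E(0)^5, hence 1, and the inverse of E(- y) is E(y). *)
have EA : E.[- x 1] * E.[- x 2] * E.[- x 3] * E.[- x 4] == E.[y] %[p^d].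
  set P := _ * E.[- x 4].
  have SP : P \in pint p by rewrite /P; repeat apply: rpredM; apply: SEx; rewrite rpredN.
  have e : E.[- y] * P == 1 %[p^d].
    have SF : E \Po (- 'X) \is a polyOver (pint p).
      by rewrite polyOver_comp // rpredN polyOverX.
    have := prod_root5_eqm p_pr zP d5 SF St; rewrite -yE.
    have -> : (E \Po - 'X).[0] = E.[0] by rewrite horner_comp !hornerE oppr0.
    have -> : \prod_(i < 5) (E \Po - 'X).[z ^+ i * y] = E.[- y] * P.
      rewrite !big_ord_recr big_ord0 /= !horner_comp !hornerN !hornerX.
      by rewrite -!/(x _) x0 /P; ring.
    move=> e; apply: eqm_trans e _; rewrite -[X in eqm _ _ _ X](expr1n _ 5).
    by apply: eqmX; rewrite ?rpred1 //; apply: gamma_poly0 EM.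
  apply: (@eqm_trans _ _ _ (E.[y] * E.[- y] * P)).
    by rewrite -[X in eqm _ _ X]mul1r; apply: eqmMr => //; apply: eqm_sym.
  by rewrite -mulrA -[X in eqm _ _ _ X]mulr1; apply: eqmMl => //; apply: SEx.
(* Since 3 y = - r p and x 1 + ... + x 4 = - y, complementary pairs of indices give arguments
   exchanged by u -> - r p - u, as [mid_prod_eqm] requires. *)
have mid i j k l : x i + x j + x k + x l = - y ->
    mid_prod p n (y - x i - x j) * (h (y - x i - x j) * h (y - x k - x l)) == -1 %[p^d].
  move=> s; have -> : y - x k - x l = - (r * p)%:R - (y - x i - x j).
    by rewrite rpE (_ : x k = - y - x i - x j - x l); [ring | rewrite -s; ring].
  apply: (mid_prod_eqm p_pr p_odd dp SE EM rn r12 (t := t - z ^+ i * t - z ^+ j * t)).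
    by rewrite !rpredB.
  by rewrite {1}yE !xE; ring.
have xsum : x 1 + x 2 + x 3 + x 4 = - y.
  rewrite /x -!mulrDl; have -> : z ^+ 1 + z ^+ 2 + z ^+ 3 + z ^+ 4 = -1.
    by apply/eqP; rewrite -subr_eq0 opprK -(root5_sum zP); apply/eqP; ring.
  by rewrite mulN1r.
have m1 := mid 1 2 3 4 xsum.
have s2 : x 1 + x 3 + x 2 + x 4 = - y by rewrite -xsum; ring.
have s3 : x 2 + x 3 + x 1 + x 4 = - y by rewrite -xsum; ring.
have m2 := mid 1 3 2 4 s2; have m3 := mid 2 3 1 4 s3.
have SN1 : -1 \in pint p by rewrite rpredN1.
(* Each of the three middle products contributes - 1, and the denominator of the quotient cancels
   against the four [h (- x i)]. Ten factors [h0] against a single one explain the exponent 9. *)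
have key : gamma_quotient * h0 ^+ 10 == - h0 %[p^d].
  apply: eqm_trans (eqmMl gamma_quotient_pint (eqm_sym ten)) _.
  have -> : - h0 = low_prod n y * (-1 * -1 * -1 * E.[y]) by rewrite /h0 /h; ring.
  have -> : gamma_quotient * (H6 * (h (- x 1) * h (- x 2) * h (- x 3) * h (- x 4))) =
      low_prod n y *
      (mid_prod p n (y - x 1 - x 2) * (h (y - x 1 - x 2) * h (y - x 3 - x 4)) *
       (mid_prod p n (y - x 1 - x 3) * (h (y - x 1 - x 3) * h (y - x 2 - x 4))) *
       (mid_prod p n (y - x 2 - x 3) * (h (y - x 2 - x 3) * h (y - x 1 - x 4))) *
       (E.[- x 1] * E.[- x 2] * E.[- x 3] * E.[- x 4])).
    have hE i : h (- x i) = E.[- x i] * low_prod n (- x i) by [].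
    rewrite !hE /H6 /gamma_quotient; move: (low_x0 1) (low_x0 2) (low_x0 3) (low_x0 4).
    move: h {hE H6 Shx h0 Sh0 Gh ten mid m1 m2 m3} => h.
    by move=> n1 n2 n3 n4; field; rewrite n1 n2 n3 n4.
  apply: eqmMl; first exact: SNx.
  have S11 : -1 * -1 \in pint p by rewrite rpredM.
  apply: (eqmM Spd) => //; [by rewrite rpredM | exact: SEx | ].
  by apply: (eqmM Spd) => //; apply: (eqmM Spd).
have SQ := gamma_quotient_pint.
apply: (@eqm_trans _ _ _ (gamma_quotient * (h0 ^+ 10 * G ^+ 10))).
  rewrite -[X in eqm _ _ X]mulr1; apply: eqmMl => //; rewrite -exprMn.
  rewrite -[X in eqm _ _ X](expr1n _ 10); apply: eqm_sym; apply: eqmX => //.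
    exact: rpred1.
  by rewrite mulrC.
rewrite mulrA; apply: eqm_trans (eqmMr _ key) _; first exact: rpredX.
rewrite (_ : - h0 * G ^+ 10 = - G ^+ 9 * (G * h0)); last by ring.
by rewrite -[X in eqm _ _ _ X]mulr1; apply: eqmMl => //; rewrite rpredN rpredX.
Qed.

End GammaQuotient.

(** * Dougall's formula *)

(** The field computation in the inductive step of [dougall_telescope], with the linear factors as
    independent letters. The last hypothesis is the polynomial identity behind the certificate. *)
Lemma dougall_step (F : fieldType) (a k2 S A1 A B1 B C D E vm vp mm mp ma va vp' mp' t : F) :
  a != 0 -> A1 != 0 -> A != 0 -> E != 0 -> mm != 0 -> mp != 0 -> ma != 0 ->
  va != 0 -> vp' != 0 -> mp' != 0 ->
  k2 * (A1 * A * mm * mp - B1 * B * vm * vp) = - S * (C * vm * mp - D * vp * mm) ->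
  k2 / a * t - va * B / (A * ma) *
     (k2 / a * (t * (B1 * ma * (vm * vp)) / (mp * mm * (A1 * va))))
   + (- S * D * vp / (a * (A1 * A) * mp)) * t =
  (- S * E * vp' / (a * (A1 * A) * mp')) * (t * (C * mp' * vm / (E * mm * vp'))).
Proof.
move=> a0 A10 A0 E0 mm0 mp0 ma0 va0 vp0 mp'0 e.
transitivity (t / (a * A1 * A * mm * mp) *
  (k2 * (A1 * A * mm * mp - B1 * B * vm * vp) - S * D * vp * mm)).
  by field; rewrite a0 A10 A0 mm0 mp0 ma0 va0.
by rewrite e; field; rewrite a0 A10 A0 mm0 mp0 E0 vp0 mp'0.
Qed.

Section Dougall.
Variables (F : numFieldType) (a b c d : F).
Let l : F := 1 + 2%:R * a - b - c - d.
Hypothesis a_neq : forall j : nat, a + j%:R != 0.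
Hypothesis ab_neq : forall j : nat, 1 + a - b + j%:R != 0.
Hypothesis ac_neq : forall j : nat, 1 + a - c + j%:R != 0.
Hypothesis ad_neq : forall j : nat, 1 + a - d + j%:R != 0.
Hypothesis l_neq : forall j : nat, l + j%:R != 0.
Hypothesis al_neq : forall i : int, a - l + i%:~R != 0.

(* The series is the very well poised 7F6 with parameters a, b, c, d, l + n
   and - n, where l + n is forced by the balancing condition. *)
Definition dougall_prod n k : F := \prod_(j < k)
  ((a + j%:R) * (b + j%:R) * (c + j%:R) * (d + j%:R) *
     (l + n%:R + j%:R) * (j%:R - n%:R) /
   (j.+1%:R * (1 + a - b + j%:R) * (1 + a - c + j%:R) * (1 + a - d + j%:R) *
     (1 + a - l - n%:R + j%:R) * (1 + a + n%:R + j%:R))).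

Definition dougall_term n k : F := (a + 2%:R * k%:R) / a * dougall_prod n k.

Definition dougall_value n : F := \prod_(j < n)
  ((1 + a + j%:R) * (1 + a - b - c + j%:R) * (1 + a - b - d + j%:R) *
     (1 + a - c - d + j%:R) /
   ((1 + a - b + j%:R) * (1 + a - c + j%:R) * (1 + a - d + j%:R) *
     (l - a + j%:R))).

Let al0 n j : a - l - n%:R + j%:R != 0.
Proof.
have := al_neq (j%:Z - n%:Z); apply: contra => /eqP e; apply/eqP; rewrite -e intrB.
rewrite -[(Posz j)%:~R]/(j%:R) -[(Posz n)%:~R]/(n%:R); ring.
Qed.

Let al1 n j : 1 + a - l - n%:R + j%:R != 0.
Proof.
have := al0 n j.+1; apply: contra => /eqP e; apply/eqP; rewrite -e -natr1; ring.
Qed.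

Let la0 j : l - a + j%:R != 0.
Proof.
have := al0 j 0; apply: contra => /eqP e; apply/eqP.
by rewrite -[RHS]oppr0 -e; ring.
Qed.

Let an n k : 1 + a + n%:R + k%:R != 0.
Proof.
have := a_neq (n + k).+1; apply: contra => /eqP e; apply/eqP.
by rewrite -e -natr1 natrD; ring.
Qed.

(** The ratio of the terms for n and n + 1, in cross-multiplied form because the factor n + 1 - k
    vanishes at k = n + 1. *)
Lemma dougall_prod_next n k :
  dougall_prod n k * ((l + n%:R + k%:R) * (a - l - n%:R + k%:R) *
    (n.+1%:R * (1 + a + n%:R))) =
  dougall_prod n.+1 k * ((l + n%:R) * (a - l - n%:R) *
    ((n%:R + 1 - k%:R) * (1 + a + n%:R + k%:R))).
Proof.
elim: k => [|k IHk]; first by rewrite /dougall_prod !big_ord0 -natr1; ring.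
have rec n' : dougall_prod n' k.+1 = dougall_prod n' k *
  ((a + k%:R) * (b + k%:R) * (c + k%:R) * (d + k%:R) *
     (l + n'%:R + k%:R) * (k%:R - n'%:R) /
   (k.+1%:R * (1 + a - b + k%:R) * (1 + a - c + k%:R) * (1 + a - d + k%:R) *
     (1 + a - l - n'%:R + k%:R) * (1 + a + n'%:R + k%:R))).
  by rewrite /dougall_prod big_ord_recr.
have X0 : (l + n%:R + k%:R) * (a - l - n%:R + k%:R) * (n.+1%:R * (1 + a + n%:R)) != 0.
  have := l_neq (n + k); rewrite natrD addrA => h.
  by rewrite !mulf_neq0 // ?pnatr_eq0 //; have := an n 0; rewrite addr0.
rewrite !rec (canRL (mulfK X0) IHk); move: X0.
have := ab_neq k; have := ac_neq k; have := ad_neq k.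
have := al1 n k; have := an n k; have : k.+1%:R != 0 :> F by rewrite pnatr_eq0.
have := al1 n.+1 k; have := an n.+1 k; rewrite -!natr1.
move: (dougall_prod n.+1 k) (n%:R) (k%:R) l => P N K L h1 h2 h3 h4 h5 h6 h7 h8.
rewrite !mulf_eq0 !negb_or => /andP[/andP[h9 h10] /andP[h11 h12]].
by field; rewrite ?(h1, h2, h3, h4, h5, h6, h7, h8, h9, h10, h11, h12).
Qed.

(* The WZ certificate: in the variables v = n + 1 + a/2, m = l + n - a/2 and
   x = k + a/2, with s ranging over a/2, b - a/2, c - a/2, d - a/2 (of sum
   v - m), the telescoping below amounts to
     2x (\prod (v - s) (m^2 - x^2) - \prod (m + s) (v^2 - x^2)) =
     (v + m) (\prod (x - s) (v + x) (m - x) - \prod (x + s) (v - x) (m + x)). *)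
Let dougall_ratio n := (1 + a + n%:R) * ((1 + a - b - c + n%:R) *
    (1 + a - b - d + n%:R) * (1 + a - c - d + n%:R)) /
  ((1 + a - b + n%:R) * (1 + a - c + n%:R) * (1 + a - d + n%:R) * (l - a + n%:R)).

Let dougall_gosper n m := - (l + 2%:R * n%:R + 1) *
  (m%:R * (a - b + m%:R) * (a - c + m%:R) * (a - d + m%:R)) *
  (1 + a + n%:R + m%:R) /
  (a * (n.+1%:R * ((1 + a - b + n%:R) * (1 + a - c + n%:R) * (1 + a - d + n%:R))) *
   (l + n%:R + m%:R)).

Lemma dougall_telescope n m :
  \sum_(k < m) (dougall_term n.+1 k - dougall_ratio n * dougall_term n k) =
  dougall_gosper n m * dougall_prod n.+1 m.
Proof.
elim: m => [|k IHk].
  by rewrite big_ord0 /dougall_gosper !(mulr0, mul0r).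
have ln j : l + n%:R + j%:R != 0 by have := l_neq (n + j); rewrite natrD addrA.
have a0 : a != 0 by have := a_neq 0; rewrite addr0.
have n1 : n.+1%:R != 0 :> F by rewrite pnatr_eq0.
have k1 : k.+1%:R != 0 :> F by rewrite pnatr_eq0.
have an0 : 1 + a + n%:R != 0 by have := an n 0; rewrite addr0.
have := ab_neq k; have := ac_neq k; have := ad_neq k => dk ck bk.
have := ab_neq n; have := ac_neq n; have := ad_neq n => dn cn bn.
have mm0 : l - a + n%:R - k%:R != 0.
  have := al0 n k; apply: contra => /eqP e; apply/eqP; rewrite -[RHS]oppr0 -e; ring.
rewrite big_ord_recr /= IHk addrC /dougall_term.
have X0 : (l + n%:R + k%:R) * (a - l - n%:R + k%:R) * (n.+1%:R * (1 + a + n%:R)) != 0.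
  by rewrite !mulf_neq0.
have -> : dougall_prod n k = dougall_prod n.+1 k * ((l + n%:R) * (l - a + n%:R) *
    ((n%:R + 1 - k%:R) * (1 + a + n%:R + k%:R))) /
    ((l + n%:R + k%:R) * (l - a + n%:R - k%:R) * (n.+1%:R * (1 + a + n%:R))).
  apply: (mulIf X0); rewrite dougall_prod_next.
  have -> : a - l - n%:R + k%:R = - (l - a + n%:R - k%:R) by ring.
  have -> : a - l - n%:R = - (l - a + n%:R) by ring.
  by move: (n.+1%:R) n1 => N1 n1; field; rewrite an0 n1 mm0 ln.
have h u : 1 + a - u + k%:R = a - u + k.+1%:R by rewrite -natr1; ring.
have rec : dougall_prod n.+1 k.+1 = dougall_prod n.+1 k *
  ((a + k%:R) * (b + k%:R) * (c + k%:R) * (d + k%:R) * (l + n%:R + k.+1%:R) *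
    (n%:R + 1 - k%:R) /
  (k.+1%:R * (a - b + k.+1%:R) * (a - c + k.+1%:R) * (a - d + k.+1%:R) *
     (l - a + n%:R - k%:R) * (1 + a + n%:R + k.+1%:R))).
  rewrite /dougall_prod big_ord_recr /=; congr (_ * _); rewrite !h.
  have -> : l + n.+1%:R + k%:R = l + n%:R + k.+1%:R by rewrite -!natr1; ring.
  have -> : k%:R - n.+1%:R = - (n%:R + 1 - k%:R) :> F by rewrite -natr1; ring.
  have -> : 1 + a - l - n.+1%:R + k%:R = - (l - a + n%:R - k%:R).
    by rewrite -natr1; ring.
  have -> : 1 + a + n.+1%:R + k%:R = 1 + a + n%:R + k.+1%:R by rewrite -!natr1; ring.
  by rewrite mulrN [X in _ / X]mulrAC mulrN invrN mulrNN [X in _ = _ / X]mulrAC.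
rewrite rec; apply: dougall_step => //.
- by rewrite !mulf_neq0.
- have [hb hc hd] := And3 (etrans (esym (congr1 (fun u => u != 0) (h b))) bk) 
    (etrans (esym (congr1 (fun u => u != 0) (h c))) ck) 
    (etrans (esym (congr1 (fun u => u != 0) (h d))) dk). 
  by rewrite !mulf_neq0.
(* The balancing condition enters the certificate here, through the definition of [l]. *)
- by rewrite -natr1 /l; ring.
Qed.

Theorem dougall n : \sum_(k < n.+1) dougall_term n k = dougall_value n.
Proof.
elim: n => [|n IHn].
  rewrite big_ord1 /dougall_term /dougall_prod /dougall_value !big_ord0.
  have a0 : a != 0 by have := a_neq 0; rewrite addr0.
  by rewrite mulr0 addr0 divff // mulr1.
(* Summing up to k = n + 1 covers both series, and the boundary term vanishes since
   [dougall_prod n.+1 n.+2] contains the factor j - (n + 1) at j = n + 1. *)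
have e := dougall_telescope n n.+2.
have z : dougall_prod n.+1 n.+2 = 0.
  by rewrite /dougall_prod big_ord_recr /= subrr !(mulr0, mul0r).
have z' : dougall_prod n n.+1 = 0.
  by rewrite /dougall_prod big_ord_recr /= subrr !(mulr0, mul0r).
move: e; rewrite z mulr0 sumrB -mulr_sumr => /eqP; rewrite subr_eq0 => /eqP ->.
rewrite big_ord_recr /= IHn [dougall_term n _]/dougall_term z' mulr0 addr0.
rewrite /dougall_value [RHS]big_ord_recr /= mulrC /dougall_ratio; congr (_ * _).
by rewrite !mulrA.
Qed.

End Dougall.

(** * Evaluation of the perturbed sum *)

(* At u = 0 this is the sum of the theorem; at u = y^5, five of the six
   parameters 1/3 become 1/3 + z^i y for the fifth roots of unity z^i. *)
Definition supersum (p : nat) (u : algC) : algC := \sum_(0 <= k < p)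
  (6 * k + 1)%:R * \prod_(j < k) ((1 / 3%:R + j%:R) / j.+1%:R *
    (((1 / 3%:R + j%:R) ^+ 5 + u) / (j.+1%:R ^+ 5 - u))).

Section DougallSpecialization.
Variables (p r n : nat) (z : algC).
Hypotheses (p_pr : prime p) (p_odd : odd p).
Hypotheses (rn : (3 * n + 1 = r * p)%N) (r12 : (r == 1%N) || (r == 2%N)).
Hypothesis zP : 5.-primitive_root z.

Let y : algC := - (r * p)%:R / 3%:R.
Let x i := z ^+ i * y.
Let a : algC := 1 / 3%:R.

Let np : (n < p)%N. Proof. by have := prime_gt1 p_pr; nia. Qed.

Let nE : n%:R = - a - y.
Proof.
by rewrite /y -rn /a natrD natrM; field.
Qed.

Let y0 : y != 0.
Proof.
rewrite mulf_neq0 ?oppr_eq0 ?invr_eq0 ?pnatr_eq0 // -rn; lia.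
Qed.

Let Ry : y \in Crat.
Proof. by rewrite rpred_div ?rpredN ?rpred_nat. Qed.

Let xsum : x 1 + x 2 + x 3 + x 4 = - y.
Proof.
rewrite /x -!mulrDl; have -> : z ^+ 1 + z ^+ 2 + z ^+ 3 + z ^+ 4 = -1.
  by apply/eqP; rewrite -subr_eq0 opprK -(root5_sum zP); apply/eqP; ring.
by rewrite mulN1r.
Qed.

Let x_irr i : ~~ (5 %| i)%N -> x i \notin Crat.
Proof.
move=> /(root5_irrational zP); apply: contra => Rx.
have -> : z ^+ i = x i / y by rewrite /x mulfK.
by rewrite rpred_div.
Qed.

Let irr_neq0 i (q u : algC) : ~~ (5 %| i)%N -> q \in Crat -> u = q - x i \/ u = q + x i -> u != 0.
Proof.
move=> /x_irr ix Rq h; apply: contra ix => /eqP u0.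
case: h; rewrite u0 => /esym/eqP; first by rewrite subr_eq0 => /eqP <-.
by rewrite addr_eq0 -rpredN => /eqP <-.
Qed.

Let b := a + x 1. Let c := a + x 2. Let d := a + x 3.

Let lE : 1 + 2%:R * a - b - c - d = 1 + y + x 4 - a.
Proof.
rewrite /b /c /d (_ : x 1 = - y - x 2 - x 3 - x 4); last by rewrite -xsum; ring.
by ring.
Qed.

Let Ra : a \in Crat. Proof. by rewrite rpred_div ?rpred1 ?rpred_nat. Qed.

Let a_neq (j : nat) : a + j%:R != 0.
Proof.
by rewrite gt_eqF // ltr_wpDr ?ler0n // divr_gt0 ?ltr01 ?ltr0n.
Qed.

Let ax_neq i (j : nat) : ~~ (5 %| i)%N -> 1 + a - (a + x i) + j%:R != 0.
Proof.
move=> i5; apply: (@irr_neq0 i (1 + j%:R)) => //; last by left; ring.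
by rewrite rpredD ?rpred1 ?rpred_nat.
Qed.

Let l_neq (j : nat) : 1 + 2%:R * a - b - c - d + j%:R != 0.
Proof.
apply: (@irr_neq0 4 (1 + y - a + j%:R)) => //; last by right; rewrite lE; ring.
by rewrite !(rpredD, rpredN) ?rpred1 ?rpred_nat.
Qed.

Let al_neq (i : int) : a - (1 + 2%:R * a - b - c - d) + i%:~R != 0.
Proof.
apply: (@irr_neq0 4 (a + a - 1 - y + i%:~R)) => //; last by left; rewrite lE; ring.
by rewrite !(rpredD, rpredN) ?rpred1 ?rpred_int.
Qed.

Let root5_prodN q : (q - x 1) * (q - x 2) * (q - x 3) * (q - x 4) * (q - y) = q ^+ 5 - y ^+ 5.
Proof.
have := root5_prod zP q (- y); rewrite exprNn (_ : (-1) ^+ 5 = -1); last by ring.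
rewrite mulN1r => <-; rewrite /x; ring.
Qed.

Let root5_prodD q : (q + x 1) * (q + x 2) * (q + x 3) * (q + x 4) * (q + y) = q ^+ 5 + y ^+ 5.
Proof. by rewrite -(root5_prod zP) /x; ring. Qed.

(** The terms with k > n vanish because 1/3 + n = - y. Among the parameters a + z^i y, the one with
    i = 0 is - n and terminates the series; the one with i = 4 is the balanced parameter l + n,
    because the fifth roots of unity sum to 0 and 3 a = 1. *)
Lemma supersum_dougall :
  supersum p (y ^+ 5) = \sum_(k < n.+1) dougall_term a b c d n k.
Proof.
rewrite /supersum (@big_cat_nat _ _ _ n.+1) //= [X in _ + X]big1_seq ?addr0; last first.
  move=> k; rewrite mem_index_iota => /andP[_ /andP[nk kp]].
  rewrite (bigD1 (Ordinal nk)) //= (_ : 1 / 3%:R + n%:R = - y); last first.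
    by rewrite nE /a; ring.
  rewrite exprNn (_ : (-1) ^+ 5 = -1); last by ring.
  by rewrite mulN1r addNr !(mul0r, mulr0).
rewrite big_mkord; apply: eq_bigr => k _; rewrite /dougall_term; congr (_ * _).
  by rewrite natrD natrM /a; field.
apply: eq_bigr => j _; rewrite -root5_prodN -root5_prodD lE -/a nE -natr1.
rewrite (_ : 1 + a - b + j%:R = j%:R + 1 - x 1); last by rewrite /b; ring.
rewrite (_ : 1 + a - c + j%:R = j%:R + 1 - x 2); last by rewrite /c; ring.
rewrite (_ : 1 + a - d + j%:R = j%:R + 1 - x 3); last by rewrite /d; ring.
have a3 : 1 = 3%:R * a by rewrite /a mulrA mulr1 mulfV ?pnatr_eq0.
have -> : 1 + a - (1 + y + x 4 - a) - (- a - y) + j%:R = j%:R + 1 - x 4.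
  by transitivity (j%:R + 3%:R * a - x 4); [ring | rewrite -a3].
have -> : 1 + y + x 4 - a + (- a - y) + j%:R = a + x 4 + j%:R.
  by transitivity (3%:R * a - 2%:R * a + x 4 + j%:R); [rewrite -a3; ring | ring].
rewrite (_ : 1 + a + (- a - y) + j%:R = j%:R + 1 - y); last by ring.
by rewrite mulf_div; congr (_ / _); rewrite /b /c /d; ring.
Qed.

Lemma low_prod_ord u : low_prod n u = \prod_(j < n) (j.+1%:R + u).
Proof. by rewrite /low_prod big_add1 big_mkord. Qed.

Lemma prod_opp_ord m (f : 'I_m -> algC) :
  \prod_(j < m) (- f j) = (-1) ^+ m * \prod_(j < m) f j.
Proof.
under eq_bigr do rewrite -mulN1r.
by rewrite big_split prodr_const card_ord.
Qed.

(** The integers from n + 1 to 2 n lie below p if r = 1; if r = 2, their only multiple of p is p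
    itself. *)
Lemma range_prod s : \prod_(j < n) (n.+1%:R + j%:R + s) =
  mid_prod p n s * (if r == 1%N then 1 else p%:R + s).
Proof.
transitivity (\prod_(n.+1 <= k < (2 * n).+1) (k%:R + s)).
  rewrite -[X in \prod_(X <= _ < _) _]add0n big_addn big_mkord.
  have -> : ((2 * n).+1 - n.+1 = n)%N by lia.
  by apply: eq_bigr => j _; rewrite natrD [n.+1%:R + _]addrC.
have multiple k : (p %| k)%N -> (0 < k)%N -> (k < 2 * p)%N -> k = p.
  move=> /dvdnP[[|[|q]] ->]; rewrite ?mul0n ?mul1n //.
  by rewrite !mulSn => _ ?; exfalso; lia.
have rn' := rn; rewrite (bigID (fun k => p %| k)%N) /= mulrC; congr (_ * _).
case/orP: r12 => /eqP re; rewrite re /= in rn' *.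
  rewrite big1_seq // => k /andP[pk]; rewrite mem_index_iota => hk.
  by have := multiple k pk; lia.
rewrite (big_rem p) /= ?dvdnn; last by rewrite mem_index_iota; lia.
rewrite big1_seq ?mulr1 // => k /andP[pk].
rewrite mem_rem_uniq ?iota_uniq // !inE mem_index_iota => /andP[/eqP kp hk].
by exfalso; apply: kp; apply: multiple => //; lia.
Qed.

Definition leading_factor : algC :=
  if r == 1%N then p%:R else 10%:R / 27%:R * p%:R ^+ 4.

(** For r = 2 one has y = - 2 p / 3, so each extra factor is 2 p / 3 times 1/2 + z^i + z^j. The
    product of the three sums is 5 / 8, and 2 p (2 p / 3)^3 (5 / 8) = (10 / 27) p^4. *)
Lemma range_extra : (r * p)%:R *
  ((if r == 1%N then 1 else p%:R + (y - x 1 - x 2)) *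
   (if r == 1%N then 1 else p%:R + (y - x 1 - x 3)) *
   (if r == 1%N then 1 else p%:R + (y - x 2 - x 3))) = leading_factor.
Proof.
rewrite /leading_factor; case: eqP => [-> | r1]; first by rewrite mul1n !mulr1.
have r2 : r = 2%N by case/orP: r12 => /eqP.
have yE : y = p%:R * (- 2%:R / 3%:R) by rewrite /y r2 natrM; field.
have e : (1 / 2%:R + z + z ^+ 2) * (1 / 2%:R + z + z ^+ 3) * (1 / 2%:R + z ^+ 2 + z ^+ 3)
   = 5%:R / 8%:R.
  apply/eqP; rewrite -subr_eq0; apply/eqP.
  (* The second factor is the quotient of the difference of the two sides by the fifth cyclotomic
     polynomial. *)
  transitivity ((1 + z + z ^+ 2 + z ^+ 3 + z ^+ 4) *
     (z ^+ 4 + z ^+ 3 + z ^+ 2 / 2%:R + z - 1 / 2%:R)); first by field.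
  by rewrite (root5_sum zP) mul0r.
transitivity (2%:R * p%:R * (2%:R / 3%:R * p%:R) ^+ 3 *
   ((1 / 2%:R + z + z ^+ 2) * (1 / 2%:R + z + z ^+ 3) * (1 / 2%:R + z ^+ 2 + z ^+ 3))).
  by rewrite /x yE r2 natrM; field.
by rewrite e; field.
Qed.

Lemma dougall_value_quotient :
  dougall_value a b c d n = leading_factor * gamma_quotient p r n z.
Proof.
have a3 : 1 = 3%:R * a by rewrite /a mulrA mulr1 mulfV ?pnatr_eq0.
rewrite /dougall_value prodf_div !big_split /=.
have lo u v : (forall j : nat, 1 + a - u + j%:R = j.+1%:R - v) ->
    \prod_(j < n) (1 + a - u + j%:R) = low_prod n (- v).
  by move=> h; rewrite low_prod_ord; apply: eq_bigr => j _; rewrite h.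
rewrite (lo b (x 1)); last by move=> j; rewrite -natr1 /b; ring.
rewrite (lo c (x 2)); last by move=> j; rewrite -natr1 /c; ring.
rewrite (lo d (x 3)); last by move=> j; rewrite -natr1 /d; ring.
have mi u v s : (forall j : nat, 1 + a - u - v + j%:R = n.+1%:R + j%:R + s) ->
    \prod_(j < n) (1 + a - u - v + j%:R) =
    mid_prod p n s * (if r == 1%N then 1 else p%:R + s).
  by move=> h; rewrite -range_prod; apply: eq_bigr => j _; rewrite h.
rewrite (mi b c (y - x 1 - x 2)); last by move=> j; rewrite -natr1 nE /b /c; ring.
rewrite (mi b d (y - x 1 - x 3)); last by move=> j; rewrite -natr1 nE /b /d; ring.
rewrite (mi c d (y - x 2 - x 3)); last by move=> j; rewrite -natr1 nE /c /d; ring.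
have -> : \prod_(j < n) (1 + 2%:R * a - b - c - d - a + j%:R) =
    (-1) ^+ n * low_prod n (- x 4).
  rewrite low_prod_ord -prod_opp_ord (reindex_inj rev_ord_inj) /=.
  apply: eq_bigr => j _; rewrite lE natrB // nE -natr1.
  by rewrite [X in X + y]a3; ring.
(* Reversal gives the product of the j + y for j < n. Trading its first factor y for n + y = - 1 / 3
   produces y / (- 1 / 3) = r p, the source of the first factor p. *)
have -> : \prod_(j < n) (1 + a + j%:R) = (-1) ^+ n * ((r * p)%:R * low_prod n y).
  transitivity ((-1) ^+ n * \prod_(j < n) (j%:R + y)).
    rewrite -prod_opp_ord (reindex_inj rev_ord_inj) /=.
    by apply: eq_bigr => j _; rewrite natrB // nE -natr1; ring.
  congr (_ * _); have e : (\prod_(j < n) (j%:R + y)) * (n%:R + y) = y * low_prod n y.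
    transitivity (\prod_(j < n.+1) (j%:R + y)); first by rewrite big_ord_recr.
    rewrite big_ord_recl add0r low_prod_ord; congr (_ * _).
  have a0 : - a != 0 by have := a_neq 0; rewrite addr0 oppr_eq0.
  apply: (mulIf a0); rewrite (_ : - a = n%:R + y) ?e; last by rewrite nE; ring.
  by rewrite nE /a /y; field.
rewrite -range_extra /gamma_quotient.
have s0 : (-1) ^+ n != 0 :> algC by rewrite signr_eq0.
rewrite -!/(x _) -/y !invfM.
move: ((-1) ^+ n) s0 => s s0; have ss := mulfV s0.
move: (s^-1) ss => si ss.
set e1 := (if _ then _ else _); set e2 := (if _ then _ else _); set e3 := (if _ then _ else _).
ring: ss.
Qed.

Lemma supersum_value : supersum p (y ^+ 5) = leading_factor * gamma_quotient p r n z.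
Proof.
rewrite supersum_dougall dougall ?dougall_value_quotient //.
- by move=> j; apply: ax_neq.
- by move=> j; apply: ax_neq.
- by move=> j; apply: ax_neq.
Qed.

End DougallSpecialization.

(** * Effect of the perturbation *)

Section Perturbation.
Variables (p r n : nat) (p_pr : prime p).
Hypotheses (rn : (3 * n + 1 = r * p)%N) (np : (n < p)%N) (p3 : coprime 3 p).

Let a : algC := 1 / 3%:R.
Let A m : {poly algC} := (m%:R ^+ 5)%:P - 'X.
Let c k : algC := \prod_(j < k) ((a + j%:R) / j.+1%:R).
(** The k-th term of [supersum], as a polynomial in u, after multiplication by the common
    denominator [D]. *)
Let tau k : {poly algC} := (6 * k + 1)%:R * (c k)%:P *
  \prod_(j < k) (((a + j%:R) ^+ 5)%:P + 'X) * \prod_(k.+1 <= m < p) A m.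
Let G := \sum_(0 <= k < p) tau k.
Let D := \prod_(1 <= m < p) A m.

Local Notation Sp := (polyOver (pint p)).
Local Notation "x == y" := 
  (eqm (polyOver_pred (pint p) : {pred {poly algC}}) p%:R x y).

Lemma eqm_polyC x y : eqm (pint p) p%:R x y -> x%:P == y%:P.
Proof.
case=> w Sw e; exists w%:P; first by rewrite -[_ \in _]/(_ \is a Sp) polyOverC.
by rewrite -polyCB e polyCM polyCMn.
Qed.

Let Sa : a \in pint p.
Proof. by rewrite rpredM ?rpred1 ?pint_nat_inv. Qed.

Let an : eqm (pint p) p%:R a (- n%:R).
Proof.
exists (r%:R / 3%:R); first by rewrite rpredM ?rpred_nat ?pint_nat_inv.
by rewrite mulrA -natrM mulnC -rn natrD natrM /a; field.
Qed.

Let SA m : A m \is a Sp.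
Proof. by rewrite rpredB ?polyOverX // polyOverC rpredX ?rpred_nat. Qed.

Let c_frac j : (j.+1 < p)%N -> (a + j%:R) / j.+1%:R \in pint p.
Proof.
by move=> jp; rewrite rpredM ?rpredD ?rpred_nat // pint_small_inv.
Qed.

Let Sc k : (k < p)%N -> c k \in pint p.
Proof.
move=> kp; apply: rpred_prod => j _; apply: c_frac; have := ltn_ord j; lia.
Qed.

Let Sprod k : \prod_(j < k) (((a + j%:R) ^+ 5)%:P + 'X) \is a Sp.
Proof.
apply: rpred_prod => j _.
by rewrite rpredD ?polyOverX // polyOverC rpredX ?rpredD ?rpred_nat.
Qed.

Let c_large k : (n < k < p)%N -> eqm (pint p) p%:R (c k) 0.
Proof.
move=> /andP[nk kp]; rewrite /c (bigD1 (Ordinal nk)) //=.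
rewrite -[X in eqm _ _ _ X](mul0r (\prod_(j < k | j != Ordinal nk) ((a + j%:R) / j.+1%:R))).
apply: eqmMr.
  by apply: rpred_prod => j _; apply: c_frac; have := ltn_ord j; lia.
rewrite -(mul0r n.+1%:R^-1); apply: eqmMr; first by rewrite pint_small_inv //; lia.
by rewrite -(addNr n%:R); apply: eqmD => //; apply: eqm_refl.
Qed.

Let Sp1 : p%:R \in (polyOver_pred (pint p) : {pred {poly algC}}).
Proof. exact: rpred_nat. Qed.

Let ST k : \prod_(k <= m < p) A m \is a Sp.
Proof. by apply: rpred_prod => m _; apply: SA. Qed.

Let tau_large k : (n < k < p)%N -> tau k == 0.
Proof.
move=> hk; pose Y := (6 * k + 1)%:R *
  (\prod_(j < k) (((a + j%:R) ^+ 5)%:P + 'X) * \prod_(k.+1 <= m < p) A m).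
have -> : tau k = (c k)%:P * Y by rewrite /tau /Y; ring.
rewrite -[X in eqm _ _ _ X](mul0r Y); apply: eqmMr.
  by apply: rpredM; [apply: rpred_nat | apply: rpredM; [exact: Sprod | exact: ST]].
by rewrite -[X in eqm _ _ _ X]polyC0; apply/eqm_polyC/c_large.
Qed.

Let B k := \prod_(k.+1 <= m < n.+1) A m.
Let T := \prod_(n.+1 <= m < p) A m.
(* Since 1/3 = - n mod p, the k-th term is antisymmetric under k -> n - k. *)
Let tau' k : {poly algC} := (3%:R * (2%:R * k%:R - n%:R)) * 'C(n, k)%:R * (B (n - k) * B k * T).

(** Modulo p, (1/3)_k / k! becomes (- n)_k / k!, a signed binomial coefficient. *)
Let c_small k : (k <= n)%N -> eqm (pint p) p%:R (c k) ((-1) ^+ k * 'C(n, k)%:R).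
Proof.
elim: k => [|k IHk] kn.
  by rewrite /c big_ord0 expr0 bin0 mulr1; apply: eqm_refl.
rewrite /c big_ord_recr -/(c k) /=.
have k0 : k.+1%:R != 0 :> algC by rewrite pnatr_eq0.
have -> : (-1) ^+ k.+1 * 'C(n, k.+1)%:R =
    (-1) ^+ k * 'C(n, k)%:R * ((- n%:R + k%:R) / k.+1%:R) :> algC.
  have := congr1 (fun u => u%:R : algC) (mul_bin_left n k).
  rewrite !natrM natrB; last exact: ltnW.
  move=> e; apply: (mulfI k0); rewrite mulrCA e exprS.
  by move: (k.+1%:R) k0 => K k0; field.
have Sk : k.+1%:R^-1 \in pint p by rewrite pint_small_inv //; lia.
apply: eqmM; rewrite ?rpred_nat //.
- by rewrite rpredM ?rpredX ?rpredN1 ?rpred_nat.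
- by rewrite rpredM // rpredD ?rpredN ?rpred_nat.
- by apply: IHk; apply: ltnW.
- by apply: eqmMr => //; apply: eqmD => //; apply: eqm_refl.
Qed.

(** Modulo p, (1/3 + j)^5 is - (n - j)^5, so each factor is the opposite of a denominator factor
    [A (n - j)]. *)
Let prod_small k : (k <= n)%N ->
  \prod_(j < k) (((a + j%:R) ^+ 5)%:P + 'X) == (-1) ^+ k * B (n - k).
Proof.
move=> kn; have -> : (-1) ^+ k * B (n - k) =
    \prod_(j < k) ((((- n%:R + j%:R) ^+ 5)%:P + 'X : {poly algC})).
  rewrite /B -[(n - k).+1]add1n big_addn.
  have -> : (n.+1 - (n - k) = k.+1)%N by lia.
  rewrite big_add1 big_mkord (reindex_inj rev_ord_inj) /=.
  have -> : (-1) ^+ k = \prod_(j < k) (-1) :> {poly algC} by rewrite prodr_const card_ord.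
  rewrite -big_split; apply: eq_bigr => j _ /=.
  have -> : ((k - j.+1).+1 + (n - k) = n - j)%N by have := ltn_ord j; lia.
  rewrite /A natrB; last by have := ltn_ord j; lia.
  rewrite mulN1r opprB addrC; congr (_ + _); rewrite -polyCN; congr (_%:P); ring.
apply: eqm_prod => // j _ _.
  by rewrite -[_ \in _]/(_ \is a Sp) rpredD ?polyOverX // polyOverC rpredX
     ?rpredD ?rpredN ?rpred_nat.
apply: eqmD; last exact: eqm_refl.
apply: eqm_polyC; apply: eqmX; rewrite ?rpredD ?rpredN ?rpred_nat //.
by apply: eqmD => //; apply: eqm_refl.
Qed.

Let tau_small k : (k <= n)%N -> tau k == tau' k.
Proof.
move=> kn; have SB j : B j \is a Sp by apply: rpred_prod => m _; apply: SA.
have -> : tau' k = (3%:R * (2%:R * k%:R - n%:R)) * ((-1) ^+ k * 'C(n, k)%:R)%:P *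
    ((-1) ^+ k * B (n - k)) * (B k * T).
  have ss : (-1) ^+ k * (-1) ^+ k = 1 :> {poly algC} by rewrite -expr2 sqrr_sign.
  have -> : ((-1) ^+ k * 'C(n, k)%:R)%:P = (-1) ^+ k * 'C(n, k)%:R :> {poly algC}.
    by rewrite rmorphM rmorphXn rmorphN rmorph1 rmorph_nat.
  rewrite /tau'; move: ((-1) ^+ k) ss => s ss; ring: ss.
have -> : B k * T = \prod_(k.+1 <= m < p) A m.
  by rewrite [RHS](@big_cat_nat _ _ _ n.+1) //=; lia.
rewrite /tau; apply: eqmMr; first exact: ST.
have S6 : 3%:R * (2%:R * k%:R - n%:R) \in (polyOver_pred (pint p) : {pred {poly algC}}).
  by rewrite rpredM ?rpredB ?rpredM ?rpred_nat.
have SC : ((-1) ^+ k * 'C(n, k)%:R)%:P \in (polyOver_pred (pint p) : {pred {poly algC}}).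
  by rewrite -[_ \in _]/(_ \is a Sp) polyOverC rpredM ?rpredX ?rpredN1 ?rpred_nat.
apply: (eqmM Sp1); last exact: prod_small.
- exact: rpredM.
- by apply: rpredM; [rewrite rpredX ?rpredN1 | exact: SB].
apply: (eqmM Sp1) => //; last exact/eqm_polyC/c_small.
(* Indeed (6 k + 1) - 3 (2 k - n) = 3 n + 1 = r p. *)
exists r%:R; first exact: rpred_nat.
by rewrite -[RHS]natrM [(p * r)%N]mulnC -rn !(natrD, natrM); ring.
Qed.

Let G_eqm0 : G == 0.
Proof.
have s0 : \sum_(0 <= k < n.+1) tau' k = 0.
  rewrite big_mkord; set s := LHS; have e : s = - s.
    rewrite {1}/s (reindex_inj rev_ord_inj) /= -sumrN; apply: eq_bigr => k _.
    rewrite subSS /tau' subKn ?bin_sub //; last by rewrite -ltnS.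
    by rewrite natrB; [ring | rewrite -ltnS].
    by rewrite -ltnS.
  have /eqP : s *+ 2 = 0 by rewrite mulr2n {1}e addNr.
  by rewrite -mulr_natl mulf_eq0 -polyCMn polyC_eq0 pnatr_eq0 => /eqP.
rewrite /G (@big_cat_nat _ _ _ n.+1) //= -[X in eqm _ _ _ X]addr0; apply: eqmD.
  rewrite -[X in eqm _ _ _ X]s0 big_nat [X in eqm _ _ _ X]big_nat; apply: eqm_sum => k hk.
  by apply: tau_small; lia.
by rewrite big_nat; apply: eqm_sum0 => k hk; apply: tau_large; lia.
Qed.

Let A_eval m v : (A m).[v] = m%:R ^+ 5 - v.
Proof. by rewrite !hornerE. Qed.

Let A_unit m v : (0 < m < p)%N -> eqm (pint p) p%:R v 0 ->
  m%:R ^+ 5 - v != 0 /\ (m%:R ^+ 5 - v)^-1 \in pint p.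
Proof.
move=> hm hv; have cm : coprimez (m ^ 5)%N p.
  rewrite /coprimez /gcdz /= eqz_nat -/(coprime _ _) coprimeXl //.
  by rewrite coprime_sym prime_coprime // gtnNdvd //; lia.
have e : eqm (pint p) p%:R (m%:R ^+ 5 - v) ((m ^ 5)%N%:~R).
  rewrite -[X in eqm _ _ _ X]subr0; apply: eqmB => //; apply: eq_eqm.
  by rewrite -[RHS]/((m ^ 5)%:R) natrX.
by split; [apply: pint_eqm_neq0 e | apply: pint_eqm_unit e].
Qed.

Let D_unit v : eqm (pint p) p%:R v 0 -> D.[v] != 0 /\ D.[v]^-1 \in pint p.
Proof.
move=> hv; rewrite horner_prod; split.
  rewrite prodf_seq_neq0; apply/allP => m; rewrite mem_index_iota /= A_eval => hm.
  by have [] := A_unit hm hv.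
rewrite -prodfV big_seq; apply: rpred_prod => m.
by rewrite mem_index_iota A_eval => hm; have [] := A_unit hm hv.
Qed.

Let supersum_horner v : eqm (pint p) p%:R v 0 -> supersum p v = G.[v] / D.[v].
Proof.
move=> hv; have [D0 _] := D_unit hv; apply: (canRL (mulfK D0)).
rewrite /supersum mulr_suml horner_sum big_nat [RHS]big_nat.
apply: eq_bigr => k /andP[_ kp].
rewrite horner_prod.
have -> : \prod_(1 <= m < p) (A m).[v] =
    \prod_(j < k) (j.+1%:R ^+ 5 - v) * \prod_(k.+1 <= m < p) (A m).[v].
  rewrite (@big_cat_nat _ _ _ k.+1) //=; congr (_ * _).
  by rewrite big_add1 big_mkord; apply: eq_bigr => j _; rewrite A_eval.
have N0 : \prod_(j < k) (j.+1%:R ^+ 5 - v) != 0.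
  apply/prodf_neq0 => j _; have jk : (0 < j.+1 < p)%N by have := ltn_ord j; lia.
  by have [] := A_unit jk hv.
rewrite big_split /= -/a -/(c k) prodf_div.
rewrite /tau !hornerM -[(6 * k + 1)%:R in RHS]polyC_natr.
rewrite !hornerC !horner_prod.
have -> : \prod_(j < k) (((a + j%:R) ^+ 5)%:P + 'X).[v] =
    \prod_(j < k) ((a + j%:R) ^+ 5 + v).
  by apply: eq_bigr => j _; rewrite !hornerE.
by move: (\prod_(j < k) (j.+1%:R ^+ 5 - v)) N0 => N N0; field.
Qed.

(** The sum is p Z(u) / D(u) with integral polynomials [Z] and [D], and [D] takes unit values at
    multiples of p. Replacing u by 0 changes [Z] and [D] by multiples of u. *)
Lemma supersum_eqm u : u \in pint p -> eqm (pint p) p%:R u 0 ->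
  eqm (pint p) (p%:R * u) (supersum p 0) (supersum p u).
Proof.
move=> Su hu; have h0 := eqm_refl (pint p : subringClosed algC) p%:R 0.
have [D0 SD0] := D_unit h0; have [Du SDu] := D_unit hu.
have [Z SZ GE] := (eqm0P (polyOver_pred (pint p) : {pred {poly algC}}) p%:R G).1 G_eqm0.
have Gv v : G.[v] = p%:R * Z.[v] by rewrite GE hornerM -[p%:R]polyC_natr hornerC.
have [w Sw wE] : eqm (pint p) u Z.[0] Z.[u].
  apply: eqm_horner => //; exists (-1); rewrite ?rpredN1 //; ring.
have SD : D \is a Sp by apply: rpred_prod => m _; apply: SA.
have [w' Sw' wE'] : eqm (pint p) u D.[0] D.[u].
  apply: eqm_horner => //; exists (-1); rewrite ?rpredN1 //; ring.
exists ((w * D.[u] - Z.[u] * w') * (D.[0]^-1 * D.[u]^-1)).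
  have SZu : Z.[u] \in pint p by rewrite rpred_horner.
  have SDu' : D.[u] \in pint p by rewrite rpred_horner.
  by repeat apply: rpredM => //; apply: rpredB; apply: rpredM.
rewrite !supersum_horner // !Gv.
transitivity (p%:R * (u * w * D.[u] - Z.[u] * (u * w')) * (D.[0]^-1 * D.[u]^-1)); last by ring.
by rewrite -wE -wE'; field; rewrite D0 Du.
Qed.

End Perturbation.

(** * Transfer to the p-adic numbers *)

Lemma supersum_gamma (p r n d m : nat) : prime p -> odd p -> coprime 3 p ->
  (3 * n + 1 = r * p)%N -> (d <= p.-1)%N ->
  ((r == 1) && (d == 5) || (r == 2) && (d == 2))%N -> (0 < m)%N ->
  eqm (pint p) (p%:R ^+ d) (p%:R * m%:R) ((r * p)%:R / 3%:R) ->
  eqm (pint p) (p%:R ^+ 6) (supersum p 0)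
    (leading_factor p r * - gamma_nat p (p * m - n) ^+ 9).
Proof.
move=> p_pr p_odd p3 rn dp rd m0 hm.
have r12 : ((r == 1) || (r == 2))%N by case/orP: rd => /andP[-> _]; rewrite ?orbT.
have d5 : (d <= 5)%N by case/orP: rd => /andP[_ /eqP ->].
have np : (n < p)%N by have := prime_gt1 p_pr; nia.
have [z zP] := C_prim_root_exists (isT : (0 < 5)%N).
have S3 : 3%:R^-1 \in pint p by exact: pint_nat_inv.
pose y : algC := - (r * p)%:R / 3%:R; pose t : algC := - r%:R / 3%:R.
have yE : y = p%:R * t by rewrite /y /t natrM; field.
have St : t \in pint p by rewrite rpredM ?rpredN ?rpred_nat.
have e1 : eqm (pint p) (p%:R ^+ 6) (supersum p 0) (supersum p (y ^+ 5)).
  apply: (@eqm_dvd _ _ _ (t ^+ 5)); first exact: rpredX.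
  have -> : p%:R ^+ 6 * t ^+ 5 = p%:R * y ^+ 5 by rewrite yE; ring.
  apply: (supersum_eqm p_pr rn np p3).
    by rewrite yE rpredX // rpredM ?rpred_nat.
  apply/eqm0P; exists (p%:R ^+ 4 * t ^+ 5); last by rewrite yE; ring.
  by rewrite rpredM ?rpredX ?rpred_nat.
apply: eqm_trans e1 _.
rewrite (supersum_value p_pr p_odd rn r12 zP).
have hG : eqm (pint p) (p%:R ^+ d) (gamma_quotient p r n z)
    (- gamma_nat p (p * m - n) ^+ 9).
  apply: gamma_quotient_eqm => //.
  by rewrite mulNr opprK.
have [c Sc ->] : exists2 c, c \in pint p & leading_factor p r = p%:R ^+ (6 - d) * c.
  rewrite /leading_factor; case/orP: rd => /andP[/eqP -> /eqP ->] /=.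
    by exists 1; rewrite ?rpred1 // mulr1.
  exists (10%:R * (3%:R^-1 ^+ 3)); first by rewrite rpredM ?rpred_nat ?rpredX.
  by field.
have := eqm_scale (p%:R ^+ (6 - d) * c) hG.
rewrite mulrAC -exprD subnK; last by lia.
exact: eqm_dvd.
Qed.

Section RationalToPadic.
Variable F : fieldType.
Hypothesis F0 : forall m : nat, (0 < m)%N -> m%:R != 0 :> F.

Let intF m : m != 0 -> m%:~R != 0 :> F.
Proof.
case: m => m m0; first by rewrite F0 // lt0n.
by rewrite NegzE mulrNz oppr_eq0 F0.
Qed.

(** Cross-multiplication reduces the claim to an identity between integers, so that characteristic 0
    is all that is asked of [F]. *)
Lemma ratr_frac (m d : int) : d != 0 -> ratr (m%:~R / d%:~R) = m%:~R / d%:~R :> F.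
Proof.
move=> d0; set x := _ / _; have x0 := denq_neq0 x.
rewrite /ratr; apply/eqP; rewrite eqr_div ?intF // -!intrM eq_sym.
apply/eqP; congr (_%:~R); apply: (@intr_inj rat); rewrite !intrM.
have d0' : d%:~R != 0 :> rat by rewrite intr_eq0.
have x0' : (denq x)%:~R != 0 :> rat by rewrite intr_eq0.
apply/eqP; rewrite -eqr_div //; apply/eqP; rewrite divq_num_den; by [].
Qed.

Let fracE (x : rat) : exists m d : int, d != 0 /\ x = m%:~R / d%:~R.
Proof. by exists (numq x), (denq x); rewrite divq_num_den denq_neq0. Qed.

Lemma ratr_add (x y : rat) : ratr (x + y) = ratr x + ratr y :> F.
Proof.
have [m [d [d0 ->]]] := fracE x; have [m' [d' [d0' ->]]] := fracE y.
rewrite addf_div ?intr_eq0 // -!intrM -intrD !ratr_frac ?mulf_neq0 //.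
by rewrite addf_div ?intF // intrD !intrM.
Qed.

Lemma ratr_mul (x y : rat) : ratr (x * y) = ratr x * ratr y :> F.
Proof.
have [m [d [d0 ->]]] := fracE x; have [m' [d' [d0' ->]]] := fracE y.
by rewrite mulf_div -!intrM !ratr_frac ?mulf_neq0 // mulf_div !intrM.
Qed.

Lemma ratr_intr (m : int) : ratr m%:~R = m%:~R :> F.
Proof. by have := @ratr_frac m 1 isT; rewrite !divr1. Qed.

End RationalToPadic.

Section PadicTransfer.
Variables (p : nat) (p_pr : prime p).
Notation Zp := (padic_int p_pr).
Notation Qp := (padic p_pr).

(** Since m < p^m, the residue of m modulo p^m is m itself. *)
Lemma padic_nat_neq0 m : (0 < m)%N -> m%:R != 0 :> Qp.
Proof.
move=> m0; rewrite -(rmorph_nat (@FracField.tofrac Zp)) tofrac_eq0.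
apply/eqP => /(congr1 (fun u : Zp => u m)); rewrite residue_nat residue0.
rewrite modz_small; first by case=> e; rewrite e in m0.
rewrite lez_nat leq0n /= -natz -[p%:Z]natz -natrX ltr_nat.
by apply: ltn_expl; apply: prime_gt1.
Qed.

Lemma ratr_padic_int (q : rat) : coprimez (denq q) p -> exists w : Zp, ratr q = w%:F :> Qp.
Proof.
move=> cq; pose D : Zp := (denq q)%:~R.
have uD : D \is a GRing.unit.
  rewrite /D -[denq q]gez0_abs // -[_%:~R]/(_%:R) padic_unit_nat -prime_coprime //.
  by move: cq; rewrite coprimez_sym /coprimez /gcdz /= eqz_nat.
exists ((numq q)%:~R / D); rewrite /ratr.
have D0 : D%:F != 0 :> Qp.
  by rewrite tofrac_eq0; apply: contraTneq uD => ->; rewrite unitr0.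
have -> : (denq q)%:~R = D%:F :> Qp by rewrite rmorph_int.
apply: (mulIf D0); rewrite divfK // -tofracM divrK //.
by rewrite rmorph_int.
Qed.

Lemma residue_eqP (u v : Zp) m : u m = v m <-> exists w, u = v + p%:R ^+ m * w.
Proof.
split=> [e|[w ->]].
  have /padic_dvdP[w wE] : (u - v) m == 0.
    by rewrite residueD residueN modzDmr e subrr mod0z.
  by exists w; rewrite -wE addrC subrK.
have /eqP e : (p%:R ^+ m * w : Zp) m == 0 by apply/padic_dvdP; exists w.
by rewrite residueD e addr0 residue_mod.
Qed.

End PadicTransfer.

Section Assembly.
Variables (p : nat) (p_pr : prime p).
Notation Zp := (padic_int p_pr).
Notation Qp := (padic p_pr).

Definition gamma_int N : int := (-1) ^+ N * \prod_(1 <= j < N | ~~ (p %| j)%N) j%:Z.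

Lemma gamma_int_intr (R : pzRingType) N : (gamma_int N)%:~R =
  (-1) ^+ N * \prod_(1 <= j < N | ~~ (p %| j)%N) j%:R :> R.
Proof.
rewrite rmorphM rmorph_sign; congr (_ * _).
by rewrite rmorph_prod; apply: eq_bigr => j _; rewrite pmulrn.
Qed.

Definition truncated_sum : rat :=
  \sum_(0 <= k < p) (6 * k + 1)%:R * (pochhammer (1 / 3) k ^+ 6 / k`!%:R ^+ 6).

Lemma ratr_truncated_sum : ratr truncated_sum = supersum p 0.
Proof.
rewrite /supersum /truncated_sum rmorph_sum; apply: eq_bigr => k _ /=.
rewrite rmorphM rmorph_nat -expr_div_n rmorphXn fmorph_div /=. congr (_ * _).
rewrite rmorph_prod rmorph_nat fact_prod big_add1 big_mkord natr_prod.
rewrite -prodf_div -prodrXl; apply: eq_bigr => j _.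
rewrite rmorphD rmorph_nat /= fmorph_div rmorph1 rmorph_nat addr0 subr0.
by rewrite -expr_div_n exprS.
Qed.

Definition leading_rat r : rat := if r == 1%N then p%:R else 10 / 27 * p%:R ^+ 4.

Lemma ratr_leading_rat r : ratr (leading_rat r) = leading_factor p r.
Proof.
rewrite /leading_rat /leading_factor; case: ifP => _; rewrite ?rmorph_nat //.
by rewrite rmorphM rmorphXn fmorph_div /= !rmorph_nat.
Qed.

Lemma truncated_sum_padic r n d : odd p -> coprime 3 p ->
  (3 * n + 1 = r * p)%N -> (d <= p.-1)%N ->
  ((r == 1) && (d == 5) || (r == 2) && (d == 2))%N ->
  padic_eqmod 6 (ratr truncated_sum : Qp)
    (- (ratr (leading_rat r) * (morita_gamma (1 / 3 : Zp))%:F ^+ 9)).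
Proof.
move=> p_odd p3 rn dp rd; have [Gc _ Gn] := morita_gammaP p_pr p_odd.
(* By continuity, an approximation of 1 / 3 modulo p^N determines the value of Gamma_p modulo
   p^d. *)
have [N hN] := Gc (1 / 3) _ (ex_intro _ d (fun y e => e) :
   nbhs (morita_gamma (1 / 3)) (fun v : Zp => v d = morita_gamma (1 / 3 : Zp) d)).
pose L := (N + d)%N; pose q := (p ^ L)%N.
have q0 : (0 < q)%N by rewrite expn_gt0 prime_gt0.
have c3q : coprime 3 q by rewrite coprimeXr.
(* Bezout gives a positive integer [m] congruent to r / 3 modulo p^(N + d). Then p m - n
   approximates 1 / 3 well enough both for the continuity above and for [supersum_gamma]. *)
have [m m0 [c mE]] : exists2 m, (0 < m)%N & exists c, (3 * m = r + c * q)%N.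
  case: (egcdnP q (isT : (0 < 3)%N)) => u v uv _; rewrite (eqP c3q) in uv.
  have r0 : (0 < r)%N by case/orP: rd => /andP[/eqP ->].
  exists (u * r)%N; last by exists (v * r)%N; rewrite mulnA [(3 * u)%N]mulnC uv; ring.
  by rewrite muln_gt0 r0 andbT; case: u uv => //; rewrite mul0n addn1.
pose M := (p * m - n)%N.
have np : (n < p)%N.
  by have := prime_gt1 p_pr; case/orP: rd => /andP[/eqP re _]; rewrite re in rn; lia.
have nM : (n < p * m)%N by apply: leq_trans np _; rewrite leq_pmulr.
have ME : (3 * M = 1 + p * (c * q))%N by rewrite /M mulnBr mulnCA mE mulnDr; lia.
have u3 : (3 : Zp) \is a GRing.unit by rewrite padic_unit_nat -prime_coprime // coprime_sym.
have M3 : M%:R = 1 / 3 + p%:R ^+ N * (p%:R ^+ d * p%:R * c%:R / 3) :> Zp.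
  apply: (mulIr u3); rewrite mulrDl divrK // -mulrA divrK //.
  have := congr1 (fun u => u%:R : Zp) ME; rewrite /q /L !(natrM, natrD, natrX) exprD mulrC => ->.
  by ring.
have [w wE] : exists w, morita_gamma M%:R = morita_gamma (1 / 3) + p%:R ^+ d * w :> Zp.
  apply/residue_eqP; apply: hN; apply/residue_eqP; eexists; exact: M3.
rewrite Gn in wE; last by rewrite /M subn_gt0.
rewrite -gamma_int_intr in wE.
pose T : rat := leading_rat r * - (gamma_int M)%:~R ^+ 9.
(* Both members are rational once the Gamma value is an integer, so the congruence between algebraic
   numbers says that this quotient has denominator prime to p. *)
have hS : ratr ((truncated_sum - T) / p%:R ^+ 6) \in pint p.
  have hm : eqm (pint p) (p%:R ^+ d) (p%:R * m%:R) ((r * p)%:R / 3%:R).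
    exists (p%:R * p%:R ^+ N * c%:R / 3%:R).
      by rewrite !rpredM ?rpredX ?rpred_nat // pint_nat_inv.
    have m3 : m%:R = (r%:R + c%:R * (p%:R ^+ N * p%:R ^+ d)) / 3%:R :> algC.
      have := congr1 (fun u => u%:R : algC) mE; rewrite /q /L !(natrM, natrD, natrX) exprD => <-.
      by field.
    by rewrite m3 natrM; field.
  have := supersum_gamma p_pr p_odd p3 rn dp rd m0 hm.
  rewrite -ratr_truncated_sum -ratr_leading_rat /gamma_nat -gamma_int_intr -/M.
  case=> v Sv e.
  have p0 : p%:R != 0 :> algC by rewrite pnatr_eq0 -lt0n prime_gt0.
  rewrite fmorph_div /= rmorphB /= rmorphXn /= rmorph_nat.
  have -> : ratr T = ratr (leading_rat r) * - (gamma_int M)%:~R ^+ 9 :> algC.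
    by rewrite rmorphM rmorphN rmorphXn /= ratr_int.
  by rewrite e mulrC mulKf ?expf_neq0.
have [v vE] := ratr_padic_int p_pr (pint_rat p_pr hS).
have F0 := @padic_nat_neq0 p p_pr.
have p0 : p%:R != 0 :> rat by rewrite pnatr_eq0 -lt0n prime_gt0.
have SE : truncated_sum = T + ((truncated_sum - T) / p%:R ^+ 6) * (p ^ 6)%N%:~R.
  by rewrite -[(p ^ 6)%N%:~R]/((p ^ 6)%:R) natrX divfK ?expf_neq0 // addrC subrK.
have [e eE] : exists e, morita_gamma (1 / 3) ^+ 9 - (gamma_int M)%:~R ^+ 9 =
    p%:R ^+ d * e :> Zp.
  by rewrite wE subrXX opprD addNKr; eexists; rewrite -mulrN -mulrA; reflexivity.
have [l lE] : exists l : Zp, ratr (leading_rat r) = (l * p%:R ^+ (6 - d))%:F :> Qp.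
  rewrite /leading_rat; case/orP: rd => /andP[/eqP -> /eqP ->] /=.
    by exists 1; rewrite mul1r expr1 -[p%:R]/(p%:~R) ratr_intr // rmorph_nat.
  exists (10 / 3 ^+ 3).
  have -> : 10 / 27 * p%:R ^+ 4 = (10 * p ^ 4)%N%:~R / 27%:~R :> rat.
    by rewrite -[(_ : nat)%:~R]/((10 * p ^ 4)%N%:R) natrM natrX; field.
  rewrite ratr_frac // rmorphM rmorph_div ?unitrX //= !rmorphXn /= !rmorph_nat.
  rewrite -[(_ : nat)%:~R]/((10 * p ^ 4)%N%:R) natrM natrX.
  by field; rewrite F0.
apply/padic_eqmodP; exists (l * e + v).
rewrite SE (ratr_add F0) (ratr_mul F0 (_ / _)) (ratr_intr F0) vE /T.
have -> : - (gamma_int M)%:~R ^+ 9 = (- gamma_int M ^+ 9)%:~R :> rat.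
  by rewrite rmorphN rmorphXn.
rewrite (ratr_mul F0) (ratr_intr F0) lE -[(p ^ 6)%N%:~R]/((p ^ 6)%:R) natrX.
have -> : (- gamma_int M ^+ 9)%:~R = (- (gamma_int M)%:~R ^+ 9 : Zp)%:F :> Qp.
  by rewrite !rmorphN !rmorphXn /= rmorph_int.
have key : l * p%:R ^+ (6 - d) * - (gamma_int M)%:~R ^+ 9 + v * p%:R ^+ 6
    + l * p%:R ^+ (6 - d) * morita_gamma (1 / 3) ^+ 9 = p%:R ^+ 6 * (l * e + v) :> Zp.
  have p6 : p%:R ^+ 6 = p%:R ^+ (6 - d) * p%:R ^+ d :> Zp.
    by rewrite -exprD subnK //; case/orP: rd => /andP[_ /eqP ->].
  transitivity (l * p%:R ^+ (6 - d) * (p%:R ^+ d * e) + v * p%:R ^+ 6).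
    by rewrite -eE; ring.
  by rewrite p6; ring.
move/(congr1 (@FracField.tofrac Zp)): key.
rewrite opprK -(rmorph_nat (@FracField.tofrac Zp) p).
by rewrite !(tofracD, tofracM, tofracXn).
Qed.

End Assembly.

(** * The truncated series in hypergeometric notation *)

Section HypergeometricForm.

Lemma pochhammerS a k : pochhammer a k.+1 = pochhammer a k * (a + k%:R).
Proof. by rewrite /pochhammer big_ord_recr. Qed.

Lemma pochhammer1 k : pochhammer 1 k = k`!%:R.
Proof.
elim: k => [|k IHk]; first by rewrite /pochhammer big_ord0.
by rewrite pochhammerS IHk factS mulnC natrM -natr1 [1 + _]addrC.
Qed.

Lemma pochhammer_neq0 a k : 0 < a -> pochhammer a k != 0.
Proof.
move=> a0; apply/prodf_neq0 => i _.
by rewrite gt_eqF // ltr_wpDr // ler0n.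
Qed.

Lemma pochhammer_shift k :
  pochhammer (7 / 6) k = (6 * k + 1)%:R * pochhammer (1 / 6) k.
Proof.
elim: k => [|k IHk]; first by rewrite /pochhammer !big_ord0.
by rewrite !pochhammerS IHk !natrD !natrM -natr1; field.
Qed.

End HypergeometricForm.

Theorem theorem1p2 (p : nat) (p_pr : prime p) (p_ge5 : (5 <= p)%N) :
  let S : rat :=
    \sum_(0 <= k < p) (6 * k + 1)%:R * (pochhammer (1 / 3) k ^+ 6 / k`!%:R ^+ 6) in
  let g : padic p_pr := (morita_gamma (1 / 3 : padic_int p_pr))%:F in
  [/\ (p = 1 %[mod 6])%N ->
        padic_eqmod 6 (ratr S) (- p%:R * g ^+ 9),
      (p = 5 %[mod 6])%N ->
        padic_eqmod 6 (ratr S) (- (10 / 27) * p%:R ^+ 4 * g ^+ 9)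
    & S = \sum_(0 <= k < p)
            pochhammer (1 / 3) k * pochhammer (7 / 6) k * pochhammer (1 / 3) k ^+ 5
            / (pochhammer (1 / 6) k * pochhammer 1 k ^+ 5) * (1 / k`!%:R)].
Proof.
move=> S g.
have p3 : coprime 3 p.
  by rewrite prime_coprime // dvdn_prime2 //; apply/eqP; lia.
have p_odd : odd p by have [e|//] := even_prime p_pr; lia.
have F0 := @padic_nat_neq0 p p_pr.
split=> [p1|p5|].
- have := @truncated_sum_padic p p_pr 1 (p %/ 3) 5 p_odd p3.
  rewrite /leading_rat eqxx (_ : ratr p%:R = p%:R) ?mulNr; last exact: (ratr_intr F0 p).
  by apply=> //; lia.
- have := @truncated_sum_padic p p_pr 2 ((2 * p) %/ 3) 2 p_odd p3.
  rewrite /leading_rat /= (ratr_mul F0).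
  have -> : ratr (p%:R ^+ 4) = p%:R ^+ 4 :> padic p_pr.
    by rewrite -!natrX; exact: (ratr_intr F0 (p ^ 4)%N).
  rewrite (@ratr_frac _ F0 10 27) // -!mulNr.
  by apply=> //; lia.
apply: eq_bigr => k _; rewrite pochhammer_shift pochhammer1.
have p6 : pochhammer (1 / 6) k != 0 by apply: pochhammer_neq0.
have f0 : k`!%:R != 0 :> rat by rewrite pnatr_eq0 -lt0n fact_gt0.
by field; rewrite p6 f0.
Qed.
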